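(* Let $T=(1,2,\ldots,d-1,d^k,d-1,\ldots,2,1)$ have height $d$ occurring $k\ge1$ times. The CIJT partitions of diagonal lengths $T$ satisfy the following. (a) Let $P$ be a CIJT partition of diagonal lengths $T$ having $d$ parts. Then the rectangular block of smallest parts of $P$ has the form $(a+k)^{a+1}$ for some $a\in[0,d-1]$, and $\iota(P)$, obtained from $P$ by replacing this block by $(a+1)^{a+k}$, is a CIJT partition of diagonal lengths $T$ having $d+k-1$ parts. The map $P\mapsto\iota(P)$ is a bijection from the set of CIJT partitions of diagonal lengths $T$ having $d$ parts to the set of those having $d+k-1$ parts. Suppose moreover $k\ge2$ and $\operatorname{char}\mathsf k=0$. Then the set of vanishing active Hessians for $\iota(P)$ is the set of vanishing active Hessians for $P$ together with $h^{d-1}$. (b) There are $2^{d-1}$ CIJT partitions of diagonal lengths $T$ with $d$ parts, and there are $2^{d-1}$ CIJT partitions of diagonal lengths $T$ with $d+k-1$ parts. (c) Let $d\ge2$. For $0\le a\le d-2$, the number of CIJT partitions of diagonal lengths $T$ having $d$ parts and smallest part $a+k$ is $2^{d-2-a}$; there is a single one whose smallest part is $d+k-1$, with multiplicity $d$. (d) Let $P=(p_1\ge p_2\ge\cdots\ge p_d)$ be a CIJT partition of diagonal lengths $T$ with $d$ parts, and let $P=P_{\ell,A}$ with $A$ a graded complete intersection quotient of $R$ and $\ell$ a nonzero linear form. Then the $i$-th string, of length $p_i$, begins in degree $i-1$: that is, $V_{i,s}=0$ unless $s=p_{i+1}$, and $\dim_{\mathsf k}V_{i-1,p_i}=1$ for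 $1\le i\le d$. The analogous statement holds for a CIJT partition of diagonal lengths $T$ with $d+k-1$ parts.
   Context: $\mathsf k$ is an infinite field of characteristic zero or of characteristic greater than $j:=2d+k-3$; $R=\mathsf k[x,y]$ with the standard grading. Here $T_i=i+1$ for $0\le i\le d-1$, $T_i=d$ for $d-1\le i\le d+k-2$, $T_i=j+1-i$ for $d+k-2\le i\le j$. The notation $p^{m}$ means the part $p$ repeated $m$ times. The diagonal lengths of a partition $P=(p_1\ge\cdots\ge p_s>0)$ are $(t_0,t_1,\ldots)$ with $t_i=\#\{(r,c): 1\le r\le s,\ 1\le c\le p_r,\ r+c-2=i\}$. The Jordan type $P_{\ell,A}$ is the partition of Jordan block sizes of multiplication $m_\ell$ by $\ell$ on $A$. A CIJT partition of diagonal lengths $T$ is a partition of diagonal lengths $T$ equal to $P_{\ell,A}$ for some graded Artinian complete intersection quotient $A$ of $R$ and nonzero linear form $\ell$. Strings: as a graded module over the polynomial ring $\mathsf k[z]$ with $z$ acting as $m_\ell$, $A$ is a direct sum of cyclic modules $\mathsf k[z]/(z^s)$ (strings of length $s$) with homogeneous generators; $V_{i,s}$ denotes the span of the generators of degree $i$ of the strings of length $s$ in such a decomposition (its dimension does not depend on the choice). Hessians ($\operatorname{char}\mathsf k=0$): $R$ acts on $\mathsf k[X,Y]$ by differentiation, written $f\circ F$; a graded complete intersection of socle degree $j$ is $A=R/\operatorname{Ann}F$ with $F\in\mathsf k[X,Y]_j$. For $0\le i\le d-1$ and a basis $(\alpha_u)$ of $A_i$, $h^i(F)=\det[\alpha_u\alpha_v\circ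 F]$, and for $\ell=ax+by$, $h^i_\ell(F)$ is its value at $(a,b)$. For $k\ge2$ the active Hessians are $h^0,\ldots,h^{d-1}$. For a CIJT partition $P=P_{\ell,A}$, $A=R/\operatorname{Ann}F$, the vanishing active Hessians for $P$ are those with $h^i_\ell(F)=0$; this set depends only on $P$. *)

(* Defs.v *)
From mathcomp Require Import all_boot all_order all_algebra.
From mathcomp Require Import mpoly.
Set Implicit Arguments.
Unset Strict Implicit.
Unset Printing Implicit Defensive.
Import GRing.Theory.
Local Open Scope ring_scope.

Definition infinite_field (K : fieldType) : Prop :=
  forall s : seq K, exists x : K, x \notin s.

Definition has_card (T : eqType) (S : T -> Prop) (n : nat) : Prop :=
  exists L : seq T, [/\ uniq L, size L = n & forall x, x \in L <-> S x].

Definition is_partition (P : seq nat) : bool :=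
  sorted geq P && (0%N \notin P).

(* Rows and columns are numbered from 0, so cell (r, c) is on diagonal r + c. *)
Definition diag_length (P : seq nat) (i : nat) : nat :=
  (\sum_(r < size P) \sum_(c < nth 0 P r) (r + c == i))%N.

(* For d, k >= 1 the subtraction is never truncated. *)
Definition socle_degree (d k : nat) : nat := (2 * d + k - 3)%N.

(* Beyond the socle degree the last branch is 0 by truncated subtraction. *)
Definition hilbT (d k i : nat) : nat :=
  if (i <= d.-1)%N then i.+1
  else if (i <= d + k - 2)%N then d
  else ((socle_degree d k).+1 - i)%N.

Definition smallest_part (P : seq nat) : nat := last 0%N P.

(* Here a is read off from the smallest part a + k of P. *)
Definition iota_part (k : nat) (P : seq nat) : seq nat :=
  let a := (smallest_part P - k)%N in
  [seq p <- P | p != smallest_part P] ++ nseq (a + k) a.+1.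

Section Algebra.
Variable K : fieldType.
Local Notation R := {mpoly K[2]}.

Definition ideal1 (f : R) : R -> Prop := fun h => exists u, h = u * f.

Definition ideal2 (f g : R) : R -> Prop :=
  fun h => exists u v, h = u * f + v * g.

Definition regular_sequence (f g : R) : Prop :=
  [/\ forall h, f * h = 0 -> h = 0,
      forall h, ideal1 f (g * h) -> ideal1 f h
    & ~ ideal2 f g 1].

(* R / I is a graded Artinian complete intersection: as R has dimension 2,
   this means that I is generated by a homogeneous regular sequence of
   length 2. *)
Definition graded_ci (I : R -> Prop) : Prop :=
  exists f g : R, exists m n : nat,
    [/\ f \is m.-homog, g \is n.-homog, regular_sequence f g
      & forall h, I h <-> ideal2 f g h].

Definition free_mod (I : R -> Prop) (s : seq R) : Prop :=
  forall c : 'I_(size s) -> K,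
    I (\sum_(i < size s) c i *: s`_i) -> forall i, c i = 0.

Definition span_mod (I : R -> Prop) (s : seq R) : R -> Prop :=
  fun r => exists c : 'I_(size s) -> K,
    I (r - \sum_(i < size s) c i *: s`_i).

(* V is a subspace of R / I, given by its preimage in R. *)
Definition has_dim_mod (I V : R -> Prop) (n : nat) : Prop :=
  exists b : seq R,
    [/\ size b = n, free_mod I b & forall r, V r <-> span_mod I b r].

Definition lform (v : 'I_2 -> K) : R := \sum_(i < 2) v i *: 'X_i.

Definition nonzero_vec (v : 'I_2 -> K) : Prop := exists i, v i != 0.

(* A string is a pair (generator, length). *)
Definition string_vectors (l : R) (gs : seq (R * nat)) : seq R :=
  flatten [seq [seq l ^+ t * g.1 | t <- iota 0 g.2] | g <- gs].

Definition string_decomposition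
    (I : R -> Prop) (l : R) (gs : seq (R * nat)) : Prop :=
  [/\ forall g, g \in gs -> (0 < g.2)%N /\ I (l ^+ g.2 * g.1),
      free_mod I (string_vectors l gs)
    & forall r, span_mod I (string_vectors l gs) r].

(* The vectors l ^+ t * g form a Jordan basis of multiplication by l on R / I,
   with one nilpotent Jordan block per string. *)
Definition jordan_type (I : R -> Prop) (l : R) (P : seq nat) : Prop :=
  is_partition P /\
  exists2 gs, string_decomposition I l gs & perm_eq P [seq g.2 | g <- gs].

Definition graded_string_decomposition
    (I : R -> Prop) (l : R) (gs : seq (R * nat)) : Prop :=
  string_decomposition I l gs /\
  forall g, g \in gs -> exists i : nat, g.1 \is i.-homog.

Definition string_space
    (I : R -> Prop) (gs : seq (R * nat)) (i s : nat) : R -> Prop :=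
  span_mod I [seq g.1 | g <- gs & (g.1 \is i.-homog) && (g.2 == s)].

(* dim V_{i,s} = n, whatever the decomposition into graded strings. *)
Definition dim_string_space
    (I : R -> Prop) (l : R) (i s n : nat) : Prop :=
  (exists gs, graded_string_decomposition I l gs) /\
  forall gs, graded_string_decomposition I l gs ->
    has_dim_mod I (string_space I gs i s) n.

Definition cijt (d k : nat) (P : seq nat) : Prop :=
  [/\ is_partition P,
      forall i, diag_length P i = hilbT d k i
    & exists (I : R -> Prop) (v : 'I_2 -> K),
        [/\ graded_ci I, nonzero_vec v & jordan_type I (lform v) P]].

Definition cijt_parts (d k n : nat) (P : seq nat) : Prop :=
  cijt d k P /\ size P = n.

Definition diff_act (f F : R) : R :=
  \sum_(m <- msupp f) f@_m *: F^`M[m].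

Definition Ann (F : R) : R -> Prop := fun f => diff_act f F = 0.

Definition basis_of_degree
    (I : R -> Prop) (i n : nat) (alpha : n.-tuple R) : Prop :=
  [/\ forall u, tnth alpha u \is i.-homog,
      free_mod I alpha
    & forall r, r \is i.-homog -> span_mod I alpha r].

Definition hessian (F : R) (n : nat) (alpha : n.-tuple R) : R :=
  \det (\matrix_(u < n, v < n) diff_act (tnth alpha u * tnth alpha v) F).

(* h^i_l(F) = 0 for l = lform v; changing the basis multiplies h^i by a
   nonzero constant. *)
Definition hessian_vanishes (F : R) (i : nat) (v : 'I_2 -> K) : Prop :=
  exists (n : nat) (alpha : n.-tuple R),
    basis_of_degree (Ann F) i alpha /\ (hessian F alpha).@[v] = 0.

Definition dual_realizes
    (d k : nat) (P : seq nat) (F : R) (v : 'I_2 -> K) : Prop :=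
  [/\ F \is (socle_degree d k).-homog, graded_ci (Ann F), nonzero_vec v
    & jordan_type (Ann F) (lform v) P].

(* V is the set of vanishing active Hessians for P, among h^0, ..., h^(d-1)
   (the active ones when k >= 2); it is the same for all F and l. *)
Definition vanishing_active_hessians
    (d k : nat) (P : seq nat) (V : {set 'I_d}) : Prop :=
  (exists F v, dual_realizes d k P F v) /\
  forall F v, dual_realizes d k P F v ->
    forall i : 'I_d, i \in V <-> hessian_vanishes F i v.

End Algebra.

(* Main.v *)
(* Let N = j + 2 = 2d + k - 1, number rows from 0, and call u + p_u the end of row u of P.
   In the graded algebra A = R/I the Jordan blocks of a linear form l are strings, one
   generated in each degree 0, 1, 2, ..., with nonincreasing lengths: the string of degree i
   is generated by a form m^i + l(...) killed by the smallest possible power of l. This is (d).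

   A partition with s parts, s = d or s = d + k - 1, has diagonal lengths T if and only if its
   ends are N - s, ..., N - 1, each taken once. Such a partition consists of rectangular
   blocks: b_1 rows of length N - b_1, then b_2 rows of length N - 2 b_1 - b_2, and so on, for
   a composition (b_1, ..., b_r) of s; iota changes only b_r, into b_r + k - 1.

   Each of these partitions occurs. Let E_0 = 1 and E_(u+1) = y E_u - x^(u+1-w) E_w, where w
   is the row whose end is one more than that of u (the last term is dropped unless w <= u).
   Then I = (E_s, x^(p_v) E_v), with v the row of smallest end, contains every x^(p_u) E_u,
   and the E_u with u < s generate strings of lengths p_u for multiplication by x. So the CIJT
   partitions with d or d + k - 1 parts are counted by compositions.

   In characteristic zero h^i_l(F) = 0 means that l^(j-2i) is not injective on A_i, that is,
   some string starting in degree u <= i has u + p_u + i <= j. *)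
Require Import Defs.
From mathcomp Require Import all_boot all_order all_algebra.
From mathcomp Require Import mpoly.
From mathcomp Require Import ssrcomplements zify.
From Stdlib Require Import ClassicalEpsilon FunctionalExtensionality PropExtensionality.
Import GRing.Theory.
Set Implicit Arguments.
Unset Strict Implicit.
Unset Printing Implicit Defensive.
Local Open Scope ring_scope.

(** * Linear algebra modulo an ideal *)

(** The recursion for [E_u] comes from a balance of exponents. When [w <= u], multiplying
    [x^(p_u) E_u] by [y] gives [x^(p_u) E_(u+1)], in [I] because rows do not get longer, plus
    [x^(p_u + u + 1 - w) E_w], and this exponent is [p_w] exactly because the end of [w] is one more
    than that of [u]. Membership in [I] thus passes from each end to the next, starting from the
    smallest end [N - s], which is the degree of the second generator. Independence of the strings
    is the harder half, as [I] has no visible basis. Setting [x = 1] loses nothing in a fixed degree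
    [n] and turns [E_u] into a polynomial of degree [u] in [y]. The forms of degree [n] in [I]
    become combinations of the [E_u] with end at most [n] and multiples of [E_s], while the strings
    meet degree [n] only in rows whose end exceeds [n]; degrees in [y] separate all of these. No
    quotient ring is formed: ideals are predicates on polynomials, and dimensions modulo an ideal
    are compared by exchange between finite families. *)

Definition ideal_pred (K : fieldType) (I : {mpoly K[2]} -> Prop) : Prop :=
  [/\ I 0, forall a b, I a -> I b -> I (a + b) & forall r a, I a -> I (r * a)].

Section Modulo.
Variables (K : fieldType) (I : {mpoly K[2]} -> Prop).
Hypothesis idealI : ideal_pred I.
Local Notation R := {mpoly K[2]}.

Lemma ideal0 : I 0. Proof. by case: idealI. Qed.
Lemma idealD a b : I a -> I b -> I (a + b). Proof. by case: idealI => _ + _; apply. Qed.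
Lemma idealM r a : I a -> I (r * a). Proof. by case: idealI => _ _; apply. Qed.
Lemma idealZ c a : I a -> I (c *: a). Proof. by rewrite -mul_mpolyC; apply: idealM. Qed.
Lemma idealN a : I a -> I (- a). Proof. by rewrite -scaleN1r; apply: idealZ. Qed.
Lemma idealB a b : I a -> I b -> I (a - b).
Proof. by move=> Ia /idealN; apply: idealD. Qed.

Lemma ideal_sum (J : Type) (r : seq J) (Q : pred J) (F : J -> R) :
  (forall j, Q j -> I (F j)) -> I (\sum_(j <- r | Q j) F j).
Proof. by move=> h; elim/big_ind: _ => //; [exact: ideal0 | exact: idealD]. Qed.

Lemma ideal_sum_seq (J : eqType) (r : seq J) (F : J -> R) :
  (forall j, j \in r -> I (F j)) -> I (\sum_(j <- r) F j).
Proof. by move=> h; rewrite big_seq; apply: ideal_sum. Qed.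

Lemma idealBl a b : I (a - b) -> I b -> I a.
Proof. by move=> h1 h2; rewrite -(subrK b a); apply: idealD. Qed.

(** [freeI] and [spanI] restate [free_mod] and [span_mod] for families indexed by a list over any
    [eqType], so that string vectors can be indexed by pairs (string, power of [l]) instead of
    positions. *)
Definition freeI (J : eqType) (idx : seq J) (v : J -> R) :=
  forall c : J -> K, I (\sum_(j <- idx) c j *: v j) -> forall j, j \in idx -> c j = 0.

Definition spanI (J : eqType) (idx : seq J) (v : J -> R) (r : R) :=
  exists c : J -> K, I (r - \sum_(j <- idx) c j *: v j).

Lemma comb_mapE (J : eqType) (idx : seq J) (v : J -> R)
    (c : 'I_(size (map v idx)) -> K) : uniq idx ->
  exists2 c' : J -> K,
    \sum_(i < size (map v idx)) c i *: (map v idx)`_i = \sum_(j <- idx) c' j *: v j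
    & forall i j0, c i = c' (nth j0 idx i).
Proof.
move=> Uidx.
exists (fun j => if insub (index j idx) is Some i then c i else 0); last first.
  move=> i j0; have := ltn_ord i; rewrite [X in (_ < X)%N]size_map => lti /=.
  by rewrite index_uniq // valK.
case: idx Uidx c => [|j0 idx] Uidx c; first by rewrite big_ord0 big_nil.
rewrite (big_nth j0) big_mkord -[X in \sum_(i < X) _ = _]/(size (map v (j0 :: idx))).
have E : size (map v (j0 :: idx)) = size (j0 :: idx) by rewrite size_map.
rewrite (reindex (cast_ord (esym E))); last first.
  by exists (cast_ord E) => i _; rewrite ?cast_ordK ?cast_ordKV.
apply: eq_bigr => i _; have lti : (i < size (j0 :: idx))%N := ltn_ord i.
rewrite (nth_map j0) // index_uniq //.
by rewrite -[nat_of_ord i]/(val (cast_ord (esym E) i)) valK.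
Qed.

Lemma map_combE (J : eqType) (idx : seq J) (v : J -> R) (c' : J -> K) :
  exists2 c : 'I_(size (map v idx)) -> K,
    \sum_(i < size (map v idx)) c i *: (map v idx)`_i = \sum_(j <- idx) c' j *: v j
    & forall i j0, c i = c' (nth j0 idx i).
Proof.
case: idx => [|j0 idx].
  by exists (fun=> 0) => [|[]//]; rewrite big_ord0 big_nil.
exists (fun i => c' (nth j0 (j0 :: idx) i)); last first.
  move=> i j1; congr c'; apply: set_nth_default.
  by have := ltn_ord i; rewrite [X in (_ < X)%N]size_map.
rewrite (big_nth j0) big_mkord.
have E : size (map v (j0 :: idx)) = size (j0 :: idx) by rewrite size_map.
rewrite (reindex (cast_ord (esym E))); last first.
  by exists (cast_ord E) => i _; rewrite ?cast_ordK ?cast_ordKV.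
apply: eq_bigr => i _; rewrite (nth_map j0) // -[X in (_ < X)%N]E.
exact: ltn_ord (cast_ord _ _).
Qed.

Lemma free_mod_map (J : eqType) (idx : seq J) (v : J -> R) : uniq idx ->
  free_mod I (map v idx) <-> freeI idx v.
Proof.
move=> Uidx; split => [H c Hc j jidx | H c].
  have [c' e1 e2] := map_combE idx v c.
  have lj : (index j idx < size (map v idx))%N by rewrite size_map index_mem.
  rewrite -(nth_index j jidx) -(e2 (Ordinal lj) j).
  by apply: H; rewrite e1.
have [c' e1 e2] := comb_mapE c Uidx.
rewrite e1 => /H {}H i.
have lti : (i < size idx)%N.
  by have := ltn_ord i; rewrite [X in (_ < X)%N]size_map.
have [j0 _] : {j : J | true}.
  by move: (val i) lti; clear; case: idx => // j0 *; exists j0.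
by rewrite (e2 i j0); apply: H; apply: mem_nth.
Qed.

Lemma span_mod_map (J : eqType) (idx : seq J) (v : J -> R) r : uniq idx ->
  span_mod I (map v idx) r <-> spanI idx v r.
Proof.
move=> Uidx; split => -[c Hc].
  by have [c' e1 _] := comb_mapE c Uidx; exists c'; rewrite -e1.
by have [c' e1 _] := map_combE idx v c; exists c'; rewrite e1.
Qed.

(** If [s] were longer than [t], the matrix of coefficients of [s] in terms of [t] would have a
    nonzero vector in its left kernel, that is, a nontrivial relation on [s] modulo [I]. *)
Lemma steinitz (s t : seq R) :
  free_mod I s -> (forall x, x \in s -> span_mod I t x) -> (size s <= size t)%N.
Proof.
move=> fs st.
have [M HM] : exists M : 'I_(size s) -> 'I_(size t) -> K, forall i : 'I_(size s),
    I (s`_i - \sum_(j < size t) M i j *: t`_j).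
  exact: (fin_all_exists (fun i => st _ (mem_nth 0 (ltn_ord i)))).
pose A := \matrix_(i, j) M i j.
rewrite leqNgt; apply/negP => lt.
have : kermx A != 0.
  rewrite -mxrank_eq0 mxrank_ker -lt0n subn_gt0.
  exact: leq_ltn_trans (rank_leq_col A) lt.
case/rowV0Pn => c /sub_kermxP cA /eqP; apply.
apply/rowP => i; rewrite [RHS]mxE; apply: (fs (fun i => c 0 i)) => {i}.
have -> : \sum_(i < size s) c 0 i *: s`_i =
   \sum_(i < size s) c 0 i *: (s`_i - \sum_(j < size t) M i j *: t`_j).
  under [RHS]eq_bigr do rewrite scalerBr scaler_sumr.
  rewrite sumrB exchange_big /= [X in _ = _ - X]big1 ?subr0 // => j _.
  under eq_bigr do rewrite scalerA.
  rewrite -scaler_suml; move/rowP/(_ j): cA; rewrite !mxE.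
  by under eq_bigr do rewrite mxE; move->; rewrite scale0r.
by apply: ideal_sum => i _; apply: idealZ.
Qed.

Lemma freeI_filter (J : eqType) (idx : seq J) (v : J -> R) (Q : pred J) :
  freeI idx v -> freeI (filter Q idx) v.
Proof.
move=> H c Hc j; rewrite mem_filter => /andP[Qj jidx].
have := H (fun j => if Q j then c j else 0) _ j jidx; rewrite Qj; apply.
move: Hc; rewrite big_filter big_mkcond; congr (I _); apply: eq_bigr => i _.
by case: ifP => // _; rewrite scale0r.
Qed.

Lemma freeI_subset (J : eqType) (s t : seq J) (w : J -> R) : uniq s -> uniq t ->
  {subset t <= s} -> freeI s w -> freeI t w.
Proof.
move=> Us Ut sub fs c hc j jt.
have := fs (fun j => if j \in t then c j else 0) _ j (sub j jt); rewrite jt; apply.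
move: hc; rewrite (perm_big (filter (mem t) s)) /=; last first.
  apply: uniq_perm; rewrite ?filter_uniq // => x; rewrite mem_filter /=.
  by case xt: (x \in t) => //=; rewrite sub.
rewrite big_filter big_mkcond; congr (I _); apply: eq_bigr => i _ /=.
by case: ifP => // _; rewrite scale0r.
Qed.

End Modulo.

(** * Strings and the uniqueness of their lengths and degrees *)

(** As a function of [a], the truncated difference [x - a] is piecewise linear, and its second
    difference is the indicator of [x = a.+1]. For string lengths [x], the sum of the [x - a] is the
    rank of [l ^+ a]. *)
Lemma double_diff_count (s : seq nat) (a : nat) :
  (\sum_(x <- s) (x - a) + \sum_(x <- s) (x - a.+2) =
   2 * (\sum_(x <- s) (x - a.+1)) + count_mem a.+1 s)%N.
Proof.
elim: s => [|x s IH]; first by rewrite !big_nil.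
rewrite !big_cons /=; move: IH.
set A := bigop _ _ _; set B := bigop _ _ _; set C := bigop _ _ _.
by move: A B C (count_mem _ _) => A B C D IH; case: eqP => [->|?]; lia.
Qed.

Lemma perm_eq_of_truncated_sums (s t : seq nat) :
    (forall x, x \in s -> 0 < x)%N -> (forall x, x \in t -> 0 < x)%N ->
    (forall a, \sum_(x <- s) (x - a) = \sum_(x <- t) (x - a))%N ->
  perm_eq s t.
Proof.
move=> s0 t0 H; apply/allP => /= [[|a]] _; apply/eqP.
  rewrite !(count_memPn _) //; first by apply/negP => /t0.
  by apply/negP => /s0.
have := double_diff_count s a; rewrite !H double_diff_count.
by move/addnI.
Qed.

(** A pair is (degree of the generator, length). The strings counted here begin in degree at most
    [n] and reach degree [e - 1]; their number is the rank of [l ^+ (e - 1 - n)] from degree [n] to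
    degree [e - 1]. *)
Definition string_through (n e : nat) (x : nat * nat) : bool :=
  (x.1 <= n)%N && (e <= x.1 + x.2)%N.

(** Inclusion-exclusion in the start and in the end isolates the strings with a prescribed start and
    a prescribed end. For start 0 only the end has to be varied. *)
Lemma count_strings_eq (s t : seq (nat * nat)) :
    (forall n e, (n < e)%N -> count (string_through n e) s = count (string_through n e) t) ->
  forall n m, (0 < m)%N -> count_mem (n, m) s = count_mem (n, m) t.
Proof.
move=> H [|n] m m0.
  have D (u : seq (nat * nat)) :
      (count (string_through 0 m) u = count_mem (0%N, m) u + count (string_through 0 m.+1) u)%N.
    elim: u => //= -[x1 x2] u ->; move: (count _ u) (count _ u) => A B.
    by rewrite /string_through /= xpair_eqE; lia.
  by have := D s; rewrite !H // D => /addIn.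
have D (u : seq (nat * nat)) :
    (count (string_through n.+1 (n.+1 + m)) u + count (string_through n (n.+1 + m).+1) u
    = count_mem (n.+1, m) u + count (string_through n.+1 (n.+1 + m).+1) u
      + count (string_through n (n.+1 + m)) u)%N.
  elim: u => //= -[x1 x2] u.
  move: (count _ u) (count _ u) (count _ u) (count _ u) (count _ u) => A B C E F.
  by rewrite /string_through /= xpair_eqE; lia.
by have := D s; rewrite !H; [rewrite D => /addIn/addIn -> | lia..].
Qed.

Section SpanModulo.
Variables (K : fieldType) (I : {mpoly K[2]} -> Prop).
Hypothesis idealI : ideal_pred I.
Local Notation R := {mpoly K[2]}.
Variables (J : eqType) (idx : seq J) (v : J -> R).
Hypothesis Uidx : uniq idx.

Lemma spanI_ideal r : I r -> spanI I idx v r.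
Proof.
by move=> Ir; exists (fun=> 0); rewrite big1 ?subr0 // => j _; rewrite scale0r.
Qed.

Lemma spanID r1 r2 : spanI I idx v r1 -> spanI I idx v r2 -> spanI I idx v (r1 + r2).
Proof.
move=> [c1 h1] [c2 h2]; exists (fun j => c1 j + c2 j).
under eq_bigr do rewrite scalerDl.
by rewrite big_split /= opprD addrACA; apply: idealD.
Qed.

Lemma spanIZ a r : spanI I idx v r -> spanI I idx v (a *: r).
Proof.
move=> [c h]; exists (fun j => a * c j).
under eq_bigr do rewrite -scalerA.
by rewrite -scaler_sumr -scalerBr; apply: idealZ.
Qed.

Lemma spanI_sum (J' : eqType) (s : seq J') (F : J' -> R) :
  (forall j, j \in s -> spanI I idx v (F j)) -> spanI I idx v (\sum_(j <- s) F j).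
Proof.
move=> h; rewrite big_seq; elim/big_ind: _ => //; last exact: spanID.
exact: spanI_ideal (ideal0 idealI).
Qed.

Lemma spanI_mem j : j \in idx -> spanI I idx v (v j).
Proof.
move=> jidx; exists (fun i => (i == j)%:R).
rewrite (bigD1_seq j) //= eqxx scale1r big1 ?addr0 ?subrr; first exact: ideal0.
by move=> i /negbTE->; rewrite scale0r.
Qed.

Lemma spanI_mull (J' : eqType) (s : seq J') (w : J' -> R) z r : spanI I s w r ->
  (forall j, j \in s -> spanI I idx v (z * w j)) -> spanI I idx v (z * r).
Proof.
move=> [c hc] hz; rewrite -(subrK (\sum_(j <- s) c j *: w j) r) mulrDr.
apply: spanID; first exact/spanI_ideal/(idealM idealI).
rewrite mulr_sumr; apply: spanI_sum => j js; rewrite -scalerAr.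
by apply: spanIZ; apply: hz.
Qed.

End SpanModulo.

Lemma count_le_of_span (K : fieldType) (I : {mpoly K[2]} -> Prop)
    (J1 J2 : eqType) (s : seq J1) (t : seq J2) (v : J1 -> {mpoly K[2]})
    (w : J2 -> {mpoly K[2]}) (Q1 : pred J1) (Q2 : pred J2) :
    ideal_pred I -> uniq s -> uniq t -> freeI I s v ->
    (forall p, p \in s -> Q1 p -> spanI I (filter Q2 t) w (v p)) ->
  (count Q1 s <= count Q2 t)%N.
Proof.
move=> idI Us Ut fs H; rewrite -!size_filter.
rewrite -(size_map v (filter Q1 s)) -(size_map w (filter Q2 t)).
apply: (steinitz idI); first exact/free_mod_map/freeI_filter/fs/filter_uniq.
move=> x /mapP[p]; rewrite mem_filter => /andP[Qp ps] ->.
by apply/span_mod_map/H; rewrite ?filter_uniq.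
Qed.

Definition string_idx (K : fieldType) (gs : seq ({mpoly K[2]} * nat)) : seq (nat * nat) :=
  [seq (i, t) | i <- iota 0 (size gs), t <- iota 0 (nth (0%R, 0%N) gs i).2].

Definition string_vec (K : fieldType) (l : {mpoly K[2]}) (gs : seq ({mpoly K[2]} * nat))
    (p : nat * nat) : {mpoly K[2]} :=
  l ^+ p.2 * (nth (0%R, 0%N) gs p.1).1.

Section Strings.
Variables (K : fieldType) (I : {mpoly K[2]} -> Prop) (l : {mpoly K[2]}).
Hypothesis idealI : ideal_pred I.
Local Notation R := {mpoly K[2]}.
Implicit Types gs : seq (R * nat).

Lemma mem_string_idx gs i t :
  ((i, t) \in string_idx gs) = (i < size gs)%N && (t < (nth (0%R, 0%N) gs i).2)%N.
Proof.
apply/allpairsPdep/andP => [[i' [t' [h1 h2 [-> ->]]]]|[h1 h2]].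
  by move: h1 h2; rewrite !mem_iota.
by exists i, t; rewrite !mem_iota.
Qed.

Lemma string_idx_uniq gs : uniq (string_idx gs).
Proof.
apply: allpairs_uniq_dep => [|i _|]; rewrite ?iota_uniq //.
by move=> [i1 t1] [i2 t2] _ _ [-> ->].
Qed.

Lemma string_vectorsE gs : string_vectors l gs = map (string_vec l gs) (string_idx gs).
Proof.
rewrite /string_vectors /string_idx map_flatten -[in LHS](mkseq_nth (0%R, 0%N) gs).
rewrite /mkseq -!map_comp; congr flatten; apply: eq_map => i /=.
by rewrite -map_comp.
Qed.

Lemma string_decompositionE gs : string_decomposition I l gs <->
  [/\ forall g, g \in gs -> (0 < g.2)%N /\ I (l ^+ g.2 * g.1),
      freeI I (string_idx gs) (string_vec l gs)
    & forall r, spanI I (string_idx gs) (string_vec l gs) r].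
Proof.
have U := string_idx_uniq gs.
rewrite /string_decomposition string_vectorsE; split=> -[h1 h2 h3]; split=> //.
- exact/free_mod_map.
- by move=> r; apply/span_mod_map.
- exact/free_mod_map.
- by move=> r; apply/span_mod_map.
Qed.

Lemma string_killed gs i t : string_decomposition I l gs ->
  (i < size gs)%N -> ((nth (0%R, 0%N) gs i).2 <= t)%N -> I (string_vec l gs (i, t)).
Proof.
move=> [h _ _] lti le; rewrite /string_vec /= -(subnK le) exprD -mulrA.
by apply: idealM => //; have [] := h _ (mem_nth (0%R, 0%N) lti).
Qed.

Lemma mul_string_vec gs a i t :
  l ^+ a * string_vec l gs (i, t) = string_vec l gs (i, a + t)%N.
Proof. by rewrite /string_vec mulrA -exprD. Qed.

(** Multiplication by [l ^+ a] moves every string vector [a] steps along its string, and the vectors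
    pushed off the string fall into [I]. *)
Lemma span_power_mul gs a r : string_decomposition I l gs ->
  spanI I [seq p <- string_idx gs | (a <= p.2)%N] (string_vec l gs) (l ^+ a * r).
Proof.
move=> sd; have [_ _ sp] := (string_decompositionE gs).1 sd.
apply: (spanI_mull idealI (sp r)) => -[i t]; rewrite mul_string_vec.
rewrite mem_string_idx => /andP[h1 h2].
have [lt|le] := ltnP (a + t) (nth (0%R, 0%N) gs i).2; last first.
  by apply: spanI_ideal => //; apply: string_killed.
apply: spanI_mem => //; first by rewrite filter_uniq ?string_idx_uniq.
by rewrite mem_filter mem_string_idx h1 lt /= leq_addr.
Qed.

(** The vectors that [l ^+ a] does not kill are sent to distinct vectors of the same basis. The
    kernel of [l ^+ a] is therefore spanned by the vectors in the last [a] places of their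
    strings. *)
Lemma string_shift_free gs (fl : seq (nat * nat)) (c : nat * nat -> K) a :
  string_decomposition I l gs -> uniq fl -> {subset fl <= string_idx gs} ->
  I (l ^+ a * \sum_(p <- fl) c p *: string_vec l gs p) ->
  forall i t, (i, t) \in fl -> (a + t < (nth (0%R, 0%N) gs i).2)%N -> c (i, t) = 0.
Proof.
move=> sd Ufl sub; have [_ fr _] := (string_decompositionE gs).1 sd.
pose Q (p : nat * nat) := (a + p.2 < (nth (0%R, 0%N) gs p.1).2)%N.
pose shift (p : nat * nat) := (p.1, (a + p.2)%N).
have shift_inj : injective shift by move=> [i1 t1] [i2 t2] [-> /addnI ->].
rewrite mulr_sumr (bigID Q) /= => Isum i t it lt.
have {}Isum : I (\sum_(p <- fl | Q p) l ^+ a * (c p *: string_vec l gs p)).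
  rewrite -[X in I X](addrK (\sum_(p <- fl | ~~ Q p) l ^+ a * (c p *: string_vec l gs p))).
  apply: idealB => //; rewrite -big_filter; apply: ideal_sum_seq => // -[i' t'].
  rewrite mem_filter => /andP[nQ /sub]; rewrite mem_string_idx => /andP[lt' _].
  rewrite -scalerAr mul_string_vec; apply: idealZ => //; apply: string_killed => //.
  by rewrite leqNgt.
have sub' : {subset [seq shift p | p <- fl & Q p] <= string_idx gs}.
  move=> q /mapP[[i' t'] + ->]; rewrite mem_filter => /andP[Qp /sub].
  by rewrite !mem_string_idx => /andP[-> _].
have U' : uniq [seq shift p | p <- fl & Q p] by rewrite map_inj_uniq ?filter_uniq.
have := freeI_subset (string_idx_uniq gs) U' sub' fr.
move=> /(_ (fun q => c (q.1, q.2 - a)%N)) /(_ _ (i, a + t)%N); rewrite /= addKn; apply.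
  rewrite big_map big_filter; move: Isum; congr (I _); apply: eq_bigr => -[i' t'] _ /=.
  by rewrite -scalerAr mul_string_vec addKn.
by apply/mapP; exists (i, t) => //; rewrite mem_filter it andbT.
Qed.

Lemma count_string_idx gs (Q : pred (nat * nat)) :
  count Q (string_idx gs) =
  (\sum_(i <- iota 0 (size gs)) count (fun t => Q (i, t)) (iota 0 (nth (0%R, 0) gs i).2))%N.
Proof.
rewrite /string_idx count_flatten sumnE !big_map; apply: eq_bigr => i _.
by rewrite count_map; apply: eq_count.
Qed.

Lemma count_iota_geq a n : count (leq a) (iota 0 n) = (n - a)%N.
Proof.
elim: n => // n IH; rewrite -addn1 iotaD count_cat IH /= add0n; lia.
Qed.

(** The vectors of power at least [a] span the image of [l ^+ a]. Exchange in both directions shows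
    that the two decompositions have equally many of them, and these ranks determine the multiset of
    lengths. *)
Lemma jordan_lengths_unique gs gs' :
  string_decomposition I l gs -> string_decomposition I l gs' ->
  perm_eq [seq g.2 | g <- gs] [seq g.2 | g <- gs'].
Proof.
have cnt gs0 a : count (fun p => (a <= p.2)%N) (string_idx gs0) =
    (\sum_(x <- [seq g.2 | g <- gs0]) (x - a))%N.
  rewrite count_string_idx big_map -[in RHS](mkseq_nth (0%R, 0%N) gs0) big_map.
  by apply: eq_bigr => i _; rewrite -count_iota_geq.
have le gs1 gs2 a : string_decomposition I l gs1 -> string_decomposition I l gs2 ->
    (\sum_(x <- [seq g.2 | g <- gs1]) (x - a) <= \sum_(x <- [seq g.2 | g <- gs2]) (x - a))%N.
  move=> sd1 sd2; have [_ fr _] := (string_decompositionE gs1).1 sd1.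
  rewrite -!cnt; apply: (count_le_of_span idealI _ _ fr) => //;
    rewrite ?string_idx_uniq //.
  move=> [i t] _ /= at_; rewrite -(subnKC at_) -mul_string_vec.
  exact: span_power_mul.
move=> sd1 sd2; apply: perm_eq_of_truncated_sums.
- by move=> x /mapP[g gin ->]; case: sd1 => + _ _; move/(_ g gin) => [].
- by move=> x /mapP[g gin ->]; case: sd2 => + _ _; move/(_ g gin) => [].
by move=> a; apply/eqP; rewrite eqn_leq !le.
Qed.

End Strings.

Section GradedStrings.
Variables (K : fieldType) (I : {mpoly K[2]} -> Prop) (l : {mpoly K[2]}).
Hypothesis idealI : ideal_pred I.
Hypothesis homogI : forall n h, I h -> I (pihomog mdeg n h).
Hypothesis homog_l : l \is 1.-homog.
Local Notation R := {mpoly K[2]}.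

Lemma homog_eqmod n (J : eqType) (s : seq J) (c : J -> K) (v : J -> R) (D : J -> nat) r :
  (forall j, j \in s -> v j \is (D j).-homog) -> r \is n.-homog ->
  I (r - \sum_(j <- s) c j *: v j) -> I (r - \sum_(j <- [seq j <- s | D j == n]) c j *: v j).
Proof.
move=> hv hr /(homogI n); rewrite linearB /= pihomog_dE //.
suff -> : pihomog mdeg n (\sum_(j <- s) c j *: v j) =
    \sum_(j <- [seq j <- s | D j == n]) c j *: v j by [].
rewrite linear_sum big_filter [RHS]big_mkcond /= !big_seq.
apply: eq_bigr => j js; rewrite linearZ /=; case: eqP => [<-|ne].
  by rewrite pihomog_dE ?hv.
by rewrite (pihomog_ne0 _ (hv j js)) ?scaler0 //; apply/eqP.
Qed.

Lemma freeI_of_graded (J : eqType) (s : seq J) (v : J -> R) (D : J -> nat) :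
  (forall j, j \in s -> v j \is (D j).-homog) ->
  (forall n, freeI I [seq j <- s | D j == n] v) -> freeI I s v.
Proof.
move=> hv H c hc j js.
apply: (H (D j) c); last by rewrite mem_filter eqxx.
move: hc => /(idealN idealI); rewrite -sub0r.
move=> /(homog_eqmod (n := D j) hv (dhomog0 _ _ _)) /(idealN idealI).
by rewrite sub0r opprK.
Qed.

Lemma homog_string_vec gs (D : nat -> nat) i t :
  (nth (0%R, 0%N) gs i).1 \is (D i).-homog -> string_vec l gs (i, t) \is (D i + t).-homog.
Proof.
by move=> h; rewrite addnC -[t in (t + _)%N]mul1n; apply/dhomogM/h/dhomogMn.
Qed.

Lemma span_power_mul_graded gs (D : nat -> nat) a n r : string_decomposition I l gs ->
    (forall i, (i < size gs)%N -> (nth (0%R, 0%N) gs i).1 \is (D i).-homog) ->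
    r \is n.-homog ->
  spanI I [seq p <- string_idx gs | (a <= p.2)%N && (D p.1 + p.2 == a + n)%N]
    (string_vec l gs) (l ^+ a * r).
Proof.
move=> sd hD hr; have [_ _ sp] := (string_decompositionE I l gs).1 sd.
have [c hc] := sp r.
have {}hc := homog_eqmod (D := fun p => (D p.1 + p.2)%N) _ hr hc.
have {}/hc hc : forall j, j \in string_idx gs -> string_vec l gs j \is (D j.1 + j.2).-homog.
  by move=> [i t]; rewrite mem_string_idx => /andP[? _]; apply: homog_string_vec; apply: hD.
apply: (spanI_mull idealI (ex_intro _ c hc)) => -[i t].
rewrite mul_string_vec mem_filter mem_string_idx => /andP[/eqP hn /andP[h1 h2]].
have [lt|le] := ltnP (a + t) (nth (0%R, 0%N) gs i).2; last first.
  by apply: spanI_ideal => //; apply: string_killed.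
apply: spanI_mem => //; first by rewrite filter_uniq ?string_idx_uniq.
by rewrite mem_filter mem_string_idx h1 lt /= leq_addr -hn addnCA eqxx.
Qed.

Definition string_pairs gs (D : nat -> nat) : seq (nat * nat) :=
  [seq (D i, (nth (0%R : R, 0%N) gs i).2) | i <- iota 0 (size gs)].

Lemma count_iota_pt (m a b n : nat) :
  count (fun t => (a <= t)%N && (b + t == m)%N) (iota 0 n) =
  ((b + a <= m)%N && (m < b + n)%N).
Proof.
elim: n => [|n IH]; first by rewrite /=; lia.
by rewrite -addn1 iotaD count_cat IH /= add0n; lia.
Qed.

(** The graded form of the same argument: the vectors of power at least [a] and degree [a + n] span
    the image of degree [n] under [l ^+ a], and each string passing through contributes exactly one
    of them. *)
Lemma graded_strings_unique gs gs' D D' :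
    string_decomposition I l gs -> string_decomposition I l gs' ->
    (forall i, (i < size gs)%N -> (nth (0%R, 0%N) gs i).1 \is (D i).-homog) ->
    (forall i, (i < size gs')%N -> (nth (0%R, 0%N) gs' i).1 \is (D' i).-homog) ->
  forall n m, (0 < m)%N ->
  count_mem (n, m) (string_pairs gs D) = count_mem (n, m) (string_pairs gs' D').
Proof.
have cnt gs0 D0 a n :
    count (fun p => (a <= p.2) && (D0 p.1 + p.2 == a + n))%N (string_idx gs0) =
    count (string_through n (a + n).+1) (string_pairs gs0 D0).
  rewrite count_string_idx count_map -[RHS]sum1_count [RHS]big_mkcond /=.
  apply: eq_bigr => i _.
  by rewrite count_iota_pt /string_through /=; case: ifP; lia.
have le gs1 gs2 D1 D2 a n : string_decomposition I l gs1 -> string_decomposition I l gs2 ->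
    (forall i, (i < size gs1)%N -> (nth (0%R, 0%N) gs1 i).1 \is (D1 i).-homog) ->
    (forall i, (i < size gs2)%N -> (nth (0%R, 0%N) gs2 i).1 \is (D2 i).-homog) ->
    (count (string_through n (a + n).+1) (string_pairs gs1 D1) <=
     count (string_through n (a + n).+1) (string_pairs gs2 D2))%N.
  move=> sd1 sd2 h1 h2; have [_ fr _] := (string_decompositionE I l gs1).1 sd1.
  rewrite -!cnt; apply: (count_le_of_span idealI _ _ fr) => //;
    rewrite ?string_idx_uniq //.
  move=> [i t]; rewrite mem_string_idx => /andP[lti _] /= /andP[at_ /eqP en].
  rewrite -(subnKC at_) -mul_string_vec.
  apply: span_power_mul_graded => //.
  have -> : n = (D1 i + (t - a))%N by lia.
  exact/homog_string_vec/h1.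
move=> sd1 sd2 h1 h2; apply: count_strings_eq => n e lt.
have -> : e = ((e.-1 - n) + n).+1 by lia.
by apply/eqP; rewrite eqn_leq !le.
Qed.

End GradedStrings.

(** * Existence of graded strings *)

Lemma minimal_nat (P : nat -> Prop) :
  (exists n, P n) -> exists n, P n /\ forall m, P m -> (n <= m)%N.
Proof.
case=> n; elim/ltn_ind: n => n IH Pn.
have [[m [lt Pm]]|h] := classic (exists m, (m < n)%N /\ P m); first exact: (IH m).
exists n; split=> // m Pm; rewrite leqNgt; apply/negP => lt.
by apply: h; exists m.
Qed.

Section Splitting.
Variables (K : fieldType).
Local Notation R := {mpoly K[2]}.

(** The forms of degree [n - 1], with only 0 allowed for [n = 0]. With this shift [l * r] has degree
    [n] without any truncated subtraction. *)
Definition homog_pred (n : nat) (r : R) : bool :=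
  if n is n'.+1 then r \is n'.-homog else r == 0.

Lemma homog_pred0 n : homog_pred n 0.
Proof. by case: n => [|n] /=; rewrite ?eqxx ?dhomog0. Qed.

Lemma homog_predD n a b : homog_pred n a -> homog_pred n b -> homog_pred n (a + b).
Proof. case: n => [/eqP->/eqP->|n] /=; [by rewrite addr0|exact: rpredD]. Qed.

Lemma homog_predZ n c a : homog_pred n a -> homog_pred n (c *: a).
Proof. case: n => [/eqP->|n] /=; [by rewrite scaler0|exact: rpredZ]. Qed.

Lemma homog_pred_mul n l r : l \is 1.-homog -> homog_pred n r -> l * r \is n.-homog.
Proof.
case: n => [_ /eqP->|n] /=; first by rewrite mulr0 dhomog0.
by move=> h1 h2; apply: (dhomogM h1 h2).
Qed.

Lemma homog_exp (m : R) n : m \is 1.-homog -> m ^+ n \is n.-homog.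
Proof. by move=> h; have := dhomogMn n h; rewrite mul1n. Qed.

Lemma homog_lform (v : 'I_2 -> K) : lform v \is 1.-homog.
Proof. by apply: rpred_sum => i _; apply: rpredZ; rewrite dhomogX /= mdeg1. Qed.

Lemma complementary_form (v : 'I_2 -> K) : nonzero_vec v ->
  exists2 m : R, m \is 1.-homog &
    forall i, exists a b, 'X_i = a *: m + b *: lform v.
Proof.
move=> nzv; rewrite /lform big_ord_recl big_ord1.
have -> : lift ord0 ord0 = 1 :> 'I_2 by apply: val_inj.
have [v0|v0] := eqVneq (v 0) 0.
  have v1 : v 1 != 0.
    case: nzv => -[[|[|//]] hi]; last by congr (v _ != 0); apply: val_inj.
    by rewrite (_ : Ordinal hi = 0) ?v0 ?eqxx //; apply: val_inj.
  exists 'X_0; first by rewrite dhomogX /= mdeg1.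
  rewrite v0 scale0r add0r => -[[|[|//]] hi].
    exists 1, 0; rewrite scale1r scale0r addr0; congr 'X_ _; exact: val_inj.
  exists 0, (v 1)^-1; rewrite scale0r add0r scalerA mulVf // scale1r.
  by congr 'X_ _; apply: val_inj.
exists 'X_1; first by rewrite dhomogX /= mdeg1.
move=> [[|[|//]] hi].
  exists (- (v 1 / v 0)), (v 0)^-1; rewrite scalerDr !scalerA mulVf // scale1r.
  rewrite addrCA [v 1 / _]mulrC scaleNr addNr addr0; congr 'X_ _; exact: val_inj.
exists 1, 0; rewrite scale1r scale0r addr0; congr 'X_ _; exact: val_inj.
Qed.

(** Induction on the degree of a monomial, one of whose variables is written in terms of [m] and
    [l]. *)
Lemma homog_split (m l : R) : m \is 1.-homog ->
    (forall i, exists a b, 'X_i = a *: m + b *: l :> R) ->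
  forall n r, r \is n.-homog ->
    exists a r', r = a *: m ^+ n + l * r' /\ homog_pred n r'.
Proof.
move=> hm hX n r hr.
pose Q (r : R) := exists a r', r = a *: m ^+ n + l * r' /\ homog_pred n r'.
have Q0 : Q 0 by exists 0, 0; rewrite scale0r mulr0 addr0 homog_pred0.
have QD r1 r2 : Q r1 -> Q r2 -> Q (r1 + r2).
  move=> [a1 [s1 [-> h1]]] [a2 [s2 [-> h2]]]; exists (a1 + a2), (s1 + s2).
  by rewrite scalerDl mulrDr addrACA homog_predD.
rewrite -/(Q r) [r]mpolyE big_seq; elim/big_ind: _ => // mm mr.
move/dhomogP/(_ _ mr): hr => hmm.
suff [a [s [-> hs]]] : Q 'X_[mm].
  exists (r@_mm * a), (r@_mm *: s); rewrite scalerDr scalerA -scalerAr.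
  by rewrite homog_predZ.
rewrite /Q; clear Q Q0 QD mr; elim: n mm hmm => [|n IH] mm /= hmm.
  exists 1, 0; rewrite /= eqxx scale1r mulr0 addr0 expr0.
  by move/eqP: hmm; rewrite mdeg_eq0 => /eqP ->; rewrite mpolyX0.
have [i hi] : exists i, (0 < mm i)%N.
  apply/existsP; rewrite -[[exists _, _]]negbK negb_exists; apply/negP => /forallP h.
  move: hmm; rewrite mdegE big1 // => i _; apply/eqP.
  by have := h i; rewrite lt0n negbK.
have em : mm = (U_(i) + (mm - U_(i)))%MM by rewrite addmC submK // lep1mP -lt0n.
have [a [s [e hs]]] : exists a s, 'X_[mm - U_(i)] = a *: m ^+ n + l * s /\ homog_pred n s.
  by apply: IH; move: hmm; rewrite {1}em mdegD mdeg1 => -[].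
have [b [c eX]] := hX i.
exists (b * a), (b *: (m * s) + c *: 'X_[mm - U_(i)]); split.
  rewrite {1}em mpolyXD eX mulrDl -!scalerAl {1}e mulrDr mulrA -!scalerAr -exprS.
  by rewrite scalerDr scalerA -addrA mulrDr -!scalerAr !mulrA [l * m]mulrC.
apply: rpredD; apply: rpredZ; first exact: homog_pred_mul.
rewrite dhomogX; apply/eqP; by move: hmm; rewrite {1}em mdegD mdeg1 add1n => -[].
Qed.

End Splitting.

Section Existence.
Variables (K : fieldType) (I : {mpoly K[2]} -> Prop) (v : 'I_2 -> K).
Hypothesis idealI : ideal_pred I.
Hypothesis homogI : forall n h, I h -> I (pihomog mdeg n h).
Hypothesis nzv : nonzero_vec v.
Local Notation R := {mpoly K[2]}.
Local Notation l := (lform v).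

(** Finite dimension of the quotient in graded form: beyond the degrees of all basis vectors, a
    combination of them has no component of degree [n]. *)
Lemma homog_ideal_of_large_degree (gs : seq (R * nat)) : string_decomposition I l gs ->
  exists N, forall n r, (N <= n)%N -> r \is n.-homog -> I r.
Proof.
move=> /string_decompositionE[_ _ sp].
exists (\max_(p <- string_idx gs) msize (string_vec l gs p)) => n r le hr.
have [c /(homogI n)] := sp r; rewrite linearB /= pihomog_dE //.
suff -> : pihomog mdeg n (\sum_(p <- string_idx gs) c p *: string_vec l gs p) = 0.
  by rewrite subr0.
rewrite linear_sum big_seq big1 // => p ps.
rewrite linearZ /= pihomogE big1_seq ?scaler0 // => m /andP[/eqP em /msize_mdeg_lt].
rewrite em ltnNge => /negP[]; apply: leq_trans le.
by rewrite (bigD1_seq p) ?leq_maxl ?string_idx_uniq.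
Qed.

Lemma graded_strings_exist (gs0 : seq (R * nat)) : string_decomposition I l gs0 ->
  exists s (e : nat -> R) (q : nat -> nat),
  [/\ forall i, e i \is i.-homog, forall i, (q i.+1 <= q i)%N,
      forall i, (i < s)%N = (0 < q i)%N
    & string_decomposition I l [seq (e i, q i) | i <- iota 0 s]].
Proof.
move=> sd0; have hl := homog_lform v.
have [m hm /(homog_split hm) hsplit] := complementary_form nzv.
have [N hN] := homog_ideal_of_large_degree sd0.
pose monic i (x : R) := exists2 r', x = m ^+ i + l * r' & homog_pred i r'.
have monic_homog i x : monic i x -> x \is i.-homog.
  move=> [r' -> hr']; apply: rpredD; last exact: homog_pred_mul.
  by exact: homog_exp.
have /(fun h i => constructive_indefinite_description _ (h i)) F : forall i,
    exists qe : nat * R, [/\ monic i qe.2, I (l ^+ qe.1 * qe.2) &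
      forall t x, monic i x -> I (l ^+ t * x) -> (qe.1 <= t)%N].
  move=> i; have [|q [[x [mx Ix]] hq]] :=
      @minimal_nat (fun t => exists x, monic i x /\ I (l ^+ t * x)).
    have mi : monic i (m ^+ i) by exists 0; rewrite ?mulr0 ?addr0 ?homog_pred0.
    exists N, (m ^+ i); split=> //; apply: (hN (N + i)%N); first exact: leq_addr.
    by apply: dhomogM; [exact: homog_exp|apply: monic_homog].
  by exists (q, x); split=> // t y my Iy; apply: hq; exists y.
pose q i := (sval (F i)).1; pose e i := (sval (F i)).2.
have me i : monic i (e i) by rewrite /e; case: (F i) => ? [].
have Ie i : I (l ^+ q i * e i) by rewrite /e /q; case: (F i) => ? [].
have qmin i t x : monic i x -> I (l ^+ t * x) -> (q i <= t)%N.
  by rewrite /q; case: (F i) => ? /= [_ _]; apply.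
(* [m * e i] is monic of degree [i.+1] and is killed by the same power of [l] as [e i]. *)
have qS i : (q i.+1 <= q i)%N.
  apply: (qmin _ _ (m * e i)); last by rewrite mulrCA; apply: idealM.
  have [r' -> hr'] := me i; exists (m * r'); first by rewrite mulrDr -exprS mulrCA.
  exact: homog_pred_mul.
have qN : q N = 0%N.
  apply/eqP; rewrite -leqn0; apply: (qmin _ _ _ (me N)); rewrite mul1r.
  exact/(hN N)/monic_homog/me.
have [s [qs smin]] : exists s, q s = 0%N /\ forall i, q i = 0%N -> (s <= i)%N.
  by apply: minimal_nat; exists N.
have qdec i j : (i <= j)%N -> (q j <= q i)%N.
  by move=> /subnKC <-; elim: (j - i)%N => [|k IH]; rewrite ?addn0 // addnS (leq_trans (qS _)).
have sP i : (i < s)%N = (0 < q i)%N.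
  case: ltnP => [lt|le]; last by have := qdec _ _ le; rewrite qs; case: (q i).
  by symmetry; rewrite lt0n; apply/eqP => /smin; rewrite leqNgt lt.
exists s, e, q; split=> //; first by move=> i; apply: monic_homog.
set gs := map _ _.
have szgs : size gs = s by rewrite size_map size_iota.
have gsE i : (i < s)%N -> nth (0%R, 0%N) gs i = (e i, q i).
  by move=> lt; rewrite (nth_map 0%N) ?size_iota // nth_iota.
have vE i t : (i < s)%N -> string_vec l gs (i, t) = l ^+ t * e i.
  by move=> lt; rewrite /string_vec gsE.
have idxE i t : (i, t) \in string_idx gs = (i < s)%N && (t < q i)%N.
  by rewrite mem_string_idx szgs; case: (ltnP i s) => // lt; rewrite gsE.
have gs_kill g : g \in gs -> (0 < g.2)%N /\ I (l ^+ g.2 * g.1).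
  by move=> /mapP[i]; rewrite mem_iota /= sP => h ->; split=> //; apply: Ie.
apply/string_decompositionE; split=> //.
  apply: (@freeI_of_graded _ _ idealI homogI _ _ _ (fun p => (p.1 + p.2)%N)).
    move=> [i t]; rewrite idxE => /andP[lt _].
    by apply: (@homog_string_vec _ _ hl _ id); rewrite gsE //; apply: monic_homog.
  move=> n c; set fl := filter _ _ => Ic.
  have flU : uniq fl by rewrite filter_uniq ?string_idx_uniq.
  have flP i t : (i, t) \in fl = [&& (i + t == n)%N, (i < s)%N & (t < q i)%N].
    by rewrite mem_filter idxE.
  (* The coefficients of a relation in degree [n] are shown to vanish from the highest row down; [k]
     bounds the distance from [i] to [s]. *)
  suff H k i t : (s - i <= k)%N -> (i, t) \in fl -> c (i, t) = 0.
    by move=> [i t]; apply: (H s); rewrite leq_subr.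
  elim: k i t => [|k IH] i t; rewrite flP => lek /and3P[/eqP en lti ltq].
    by move: lek lti; rewrite leqn0 subn_eq0 ltnNge => ->.
  apply/eqP; apply/negPn/negP => nzc.
  (* In degree [n] the rows below [i] carry powers of [l] greater than [t], so [l ^+ t] divides what
     is left of the relation, and [w] is the cofactor with one further [l] taken out. Dividing by
     [c (i, t)] then gives a monic form [E] of degree [i] with [l ^+ t * E] in [I], against the
     minimality of [q i > t]. *)
  pose w (p : nat * nat) := if (p.1 < i)%N then l ^+ (i - p.1).-1 * e p.1 else 0.
  have itfl : (i, t) \in fl by rewrite flP en eqxx lti.
  pose E := (c (i, t))^-1 *: (c (i, t) *: e i + l * \sum_(p <- fl | p != (i, t)) c p *: w p).
  suff : (q i <= t)%N by rewrite leqNgt ltq.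
  apply: (qmin i t E).
    have [r' er hr'] := me i.
    exists (r' + (c (i, t))^-1 *: \sum_(p <- fl | p != (i, t)) c p *: w p).
      by rewrite /E scalerDr scalerA mulVf // scale1r er mulrDr addrA scalerAr.
    apply: homog_predD => //; apply: homog_predZ.
    elim/big_rec: _ => [|p x _ hx]; first exact: homog_pred0.
    apply: homog_predD => //; apply: homog_predZ; rewrite /w.
    case: ltnP => [lt|_]; last exact: homog_pred0.
    case: (i) lt => //= i' lt; rewrite subSn //= -{2}(subnK (lt : p.1 <= i')%N).
    by apply: dhomogM; [exact: homog_exp|apply: monic_homog].
  rewrite /E -scalerAr; apply: idealZ => //; move: Ic.
  rewrite (bigD1_seq (i, t)) //= vE // scalerAr => Ic. 
  rewrite mulrDr; suff -> : l ^+ t * (l * \sum_(p <- fl | p != (i, t)) c p *: w p) =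
      \sum_(p <- fl | p != (i, t)) c p *: string_vec l gs p.
    by [].
  rewrite !mulr_sumr big_seq_cond [RHS]big_seq_cond; apply: eq_bigr => -[i' t'].
  move=> /andP[inf ne]; have := inf; rewrite flP => /and3P[/eqP en' lti' _].
  rewrite /w /=; case: (ltngtP i' i) => [lt|lt|eq].
  - rewrite -!scalerAr vE // !mulrA -exprSr -exprD; congr (_ *: (l ^+ _ * _)); lia.
  - by rewrite (IH i' t') ?scale0r ?mulr0 //; lia.
  - by case/eqP: ne; congr pair; lia.
have Uidx := string_idx_uniq gs.
have lstable r : spanI I (string_idx gs) (string_vec l gs) r ->
    spanI I (string_idx gs) (string_vec l gs) (l * r).
  move=> hr; apply: (spanI_mull idealI hr) => -[i t]; rewrite idxE => /andP[lti _].
  rewrite vE // mulrA -exprS -vE //.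
  have [lt|le] := ltnP t.+1 (q i); first by apply: spanI_mem => //; rewrite idxE lti.
  apply: spanI_ideal => //; rewrite vE // -(subnK le) exprD -mulrA.
  exact: idealM.
have spe n : spanI I (string_idx gs) (string_vec l gs) (e n).
  case: (ltnP n s) => lt.
    by rewrite -[e n]mul1r -(expr0 l) -vE //; apply: spanI_mem => //; rewrite idxE lt -sP.
  apply: spanI_ideal => //; rewrite -[e n]mul1r -(expr0 l).
  by have := Ie n; move: lt; rewrite leqNgt sP; case: (q n).
(* Up to a multiple of [e n], a form of degree [n] is [l] times a form of degree one less, and the
   span of the strings is stable under [l]. *)
have sph n r : r \is n.-homog -> spanI I (string_idx gs) (string_vec l gs) r.
  elim: n r => [|n IH] r /hsplit[a [r' [er hr']]].
    move: hr' er => /eqP ->; rewrite mulr0 addr0 => ->; apply: spanIZ => //.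
    by have := spe 0%N; have [x -> /eqP ->] := me 0%N; rewrite mulr0 addr0.
  have [x ex hx] := me n.+1.
  have -> : r = a *: e n.+1 + l * (r' - a *: x).
    by rewrite er ex mulrBr scalerDr -scalerAr [RHS]addrACA subrr addr0.
  apply: spanID; rewrite ?spanIZ //; first exact: spanIZ.
  by apply: lstable; apply: IH; apply: rpredB => //; apply: rpredZ.
move=> r; rewrite (pihomog_partitionE (leqnn (mmeasure mdeg r))).
by apply: spanI_sum => // d _; apply: (sph d); apply: pihomogP.
Qed.

End Existence.

(** * Strings of a graded complete intersection *)

Section CompleteIntersection.
Variables (K : fieldType).
Local Notation R := {mpoly K[2]}.

Lemma pihomog_mul_homog n m (u f : R) : f \is m.-homog ->
  exists u', pihomog mdeg n (u * f) = u' * f.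
Proof.
move=> hf; exists (\sum_(d < mmeasure mdeg u | (d + m == n)%N) pihomog mdeg d u).
rewrite {1}(pihomog_partitionE (leqnn (mmeasure mdeg u))) mulr_suml linear_sum /=.
rewrite mulr_suml [RHS]big_mkcond /=; apply: eq_bigr => d _.
have h : pihomog mdeg d u * f \is (d + m).-homog by apply: dhomogM; rewrite ?pihomogP.
case: eqP => [<-|/eqP ne]; first by rewrite pihomog_dE.
exact: pihomog_ne0 ne h.
Qed.

Lemma ideal2_ideal (f g : R) : ideal_pred (ideal2 f g).
Proof.
split.
- by exists 0, 0; rewrite !mul0r addr0.
- move=> a b [u1 [v1 ->]] [u2 [v2 ->]]; exists (u1 + u2), (v1 + v2).
  by rewrite !mulrDl addrACA.
- by move=> r a [u [v ->]]; exists (r * u), (r * v); rewrite mulrDr !mulrA.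
Qed.

Lemma ideal2_homog (f g : R) m m' : f \is m.-homog -> g \is m'.-homog ->
  forall n h, ideal2 f g h -> ideal2 f g (pihomog mdeg n h).
Proof.
move=> hf hg n h [u [v ->]].
have [u' eu] := pihomog_mul_homog n u hf; have [v' ev] := pihomog_mul_homog n v hg.
by exists u', v'; rewrite linearD /= eu ev.
Qed.

Variable I : R -> Prop.

Lemma graded_ci_ideal : graded_ci I -> ideal_pred I.
Proof.
move=> [f [g [m [n [_ _ _ hI]]]]]; have [i0 iD iM] := ideal2_ideal f g.
split; first exact/hI.
- by move=> a b /hI ha /hI hb; apply/hI/iD.
- by move=> r a /hI ha; apply/hI/iM.
Qed.

Lemma graded_ci_homog : graded_ci I -> forall n h, I h -> I (pihomog mdeg n h).
Proof.
move=> [f [g [m [m' [hf hg _ hI]]]]] n h /hI If; apply/hI.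
exact: ideal2_homog hf hg n h If.
Qed.

Hypothesis ciI : graded_ci I.
Variable v : 'I_2 -> K.
Hypothesis nzv : nonzero_vec v.
Local Notation l := (lform v).

(** The lengths produced by [graded_strings_exist] are already nonincreasing. Being a permutation of
    the parts of [P], they are [P] itself, in order. *)
Lemma jordan_graded_strings P : jordan_type I l P ->
  exists2 e : nat -> R, forall i, e i \is i.-homog &
    string_decomposition I l [seq (e i, nth 0%N P i) | i <- iota 0 (size P)].
Proof.
have idI := graded_ci_ideal ciI; have hoI := graded_ci_homog ciI.
move=> [/andP[sP P0] [gs sd pe]].
have [s [e [q [he qS qs sd']]]] := graded_strings_exist idI hoI nzv sd.
exists e => //.
have := perm_trans pe (jordan_lengths_unique idI sd sd').
rewrite -map_comp (eq_map (_ : _ =1 q)) // => pq.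
have eP : P = [seq q i | i <- iota 0 s].
  apply: (sorted_eq _ _ sP) => //; first by move=> x y z; rewrite /geq; lia.
    by move=> x y; rewrite /geq => /andP[]; lia.
  apply: (homo_sorted (e := ltn)) (iota_ltn_sorted 0 s) => i j ltij.
  rewrite /= /geq -(subnKC (ltnW ltij)).
  by elim: (j - i)%N => [|k IH]; rewrite ?addn0 // addnS (leq_trans (qS _)).
have sP' : size P = s by rewrite eP size_map size_iota.
rewrite sP'; move: sd'; congr (string_decomposition I l _).
apply/eq_in_map => i; rewrite mem_iota /= => lti.
by rewrite eP (nth_map 0%N) ?size_iota // nth_iota.
Qed.

(** One decomposition has exactly one string in each degree [i < size P], of length the part
    numbered [i]; the multiplicity of a pair (degree, length) is the same in all graded
    decompositions. *)
Lemma dim_string_spaceP P i s : jordan_type I l P ->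
  dim_string_space I l i s ((i < size P) && (s == nth 0 P i))%N.
Proof.
have idI := graded_ci_ideal ciI; have hoI := graded_ci_homog ciI.
have hl := homog_lform v => jt.
have [e he sd] := jordan_graded_strings jt.
set gs0 := map _ _ in sd.
have sz0 : size gs0 = size P by rewrite size_map size_iota.
have gs0E j : (j < size P)%N -> nth (0%R, 0%N) gs0 j = (e j, nth 0%N P j).
  by move=> lt; rewrite (nth_map 0%N) ?size_iota // nth_iota.
split.
  exists gs0; split=> // g /mapP[j _ ->]; exists j; exact: he.
move=> gs [sdg hgs]; have [gs1 gs2 gs3] := (string_decompositionE I l gs).1 sdg.
(* A zero generator would pass the homogeneity test in every degree and be counted several times;
   freeness excludes it. *)
have nz j : (j < size gs)%N -> (nth (0%R, 0%N) gs j).1 != 0.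
  move=> lt; apply/eqP => e0.
  have := gs2 (fun p => (p == (j, 0%N))%:R) _ (j, 0%N).
  rewrite mem_string_idx lt (gs1 _ (mem_nth _ lt)).1 eqxx => /(_ _ isT) H.
  have /eqP := oner_neq0 K; apply; apply: H; apply: ideal_sum => // p _.
  case: eqP => [->|_]; last by rewrite scale0r; apply: ideal0.
  by rewrite /string_vec e0 mulr0 scaler0; apply: ideal0.
have /(fun h j => constructive_indefinite_description _ (h j)) F : forall j, exists d,
    (j < size gs)%N -> (nth (0%R, 0%N) gs j).1 \is d.-homog.
  move=> j; case: (ltnP j (size gs)) => lt; last by exists 0%N.
  by have [d hd] := hgs _ (mem_nth (0%R, 0%N) lt); exists d.
pose D j := sval (F j).
have hD j : (j < size gs)%N -> (nth (0%R, 0%N) gs j).1 \is (D j).-homog.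
  by rewrite /D; case: (F j).
pose Q (g : R * nat) := (g.1 \is i.-homog) && (g.2 == s).
pose js := [seq (j, 0%N) | j <- iota 0 (size gs) & Q (nth (0%R, 0%N) gs j)].
have bE : [seq g.1 | g <- gs & Q g] = [seq string_vec l gs p | p <- js].
  rewrite -map_comp -[in LHS](mkseq_nth (0%R, 0%N) gs) filter_map -map_comp.
  by apply: eq_map => j; rewrite /= /string_vec mul1r.
have Ujs : uniq js by rewrite map_inj_uniq ?filter_uniq ?iota_uniq // => x y [].
exists [seq g.1 | g <- gs & Q g]; split=> //; last first.
  rewrite bE; apply/free_mod_map => //; apply: freeI_subset gs2; rewrite ?string_idx_uniq //.
  move=> [j t] /mapP[j' + [-> ->]]; rewrite mem_filter mem_iota mem_string_idx.
  move=> /andP[_ /= lt].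
  by rewrite lt (gs1 _ (mem_nth _ lt)).1.
have cQ : size [seq g.1 | g <- gs & Q g] =
    if (0 < s)%N then count_mem (i, s) (string_pairs gs D) else 0%N.
  rewrite size_map size_filter; case: ltnP => [s0|]; last first.
    rewrite leqn0 => /eqP s0; apply/eqP; rewrite -leqn0 leqNgt -has_count.
    apply/hasPn => g /gs1[g0 _]; rewrite /Q s0 negb_and; apply/orP; right.
    by rewrite -lt0n.
  rewrite -[in LHS](mkseq_nth (0%R, 0%N) gs) !count_map; apply: eq_in_count => j.
  rewrite mem_iota /= => lt; rewrite /Q xpair_eqE; congr (_ && _).
  apply/idP/eqP => [h|<-]; last exact: hD.
  exact: dhomog_uniq (nz _ lt) (hD _ lt) h.
rewrite {}cQ; have P0 : (0 < s)%N || (0 < nth 0 P i)%N || (size P <= i)%N.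
  case: (ltnP i (size P)) => [lt|]; last by rewrite orbT.
  case: jt => /andP[_ P0] _; rewrite orbF; apply/orP; right; rewrite lt0n.
  by apply: contraNneq P0 => <-; apply: mem_nth.
case: ltnP => [s0|s0]; last by move: P0 s0; lia.
rewrite (graded_strings_unique idI hoI hl sdg sd (D' := id) hD) //; last first.
  by move=> j; rewrite sz0 => lt; rewrite gs0E //; apply: he.
rewrite /string_pairs sz0 count_map.
rewrite (eq_in_count (a2 := fun j => (j == i) && (s == nth 0%N P i))); last first.
  move=> j; rewrite mem_iota /= => lt; rewrite gs0E // xpair_eqE [s == _]eq_sym.
  by case: eqP => [->|].
case: eqP => _; last first.
  by rewrite andbF (eq_count (a2 := pred0)) ?count_pred0 // => j; rewrite andbF.
rewrite andbT; have := count_uniq_mem i (iota_uniq 0 (size P)).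
rewrite mem_iota /= add0n => <-.
by apply: eq_count => j; rewrite andbT.
Qed.

End CompleteIntersection.

(** * Partitions and their row ends *)

Section Combinatorics.
Local Open Scope nat_scope.

Definition ends (P : seq nat) : seq nat := [seq i + nth 0 P i | i <- iota 0 (size P)].

Fixpoint block_partition (N : nat) (bs : seq nat) : seq nat :=
  if bs is b :: bs' then nseq b (N - b) ++ block_partition (N - 2 * b) bs' else [::].

Definition composition (n : nat) (bs : seq nat) : bool :=
  all (leq 1) bs && (sumn bs == n).

Lemma size_ends P : size (ends P) = size P.
Proof. by rewrite size_map size_iota. Qed.

Lemma nth_ends P i : i < size P -> nth 0 (ends P) i = i + nth 0 P i.
Proof. by move=> lt; rewrite (nth_map 0) ?size_iota // nth_iota. Qed.

Lemma ends_block b x P : ends (nseq b x ++ P) = iota x b ++ map (addn b) (ends P).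
Proof.
rewrite /ends size_cat size_nseq iotaD map_cat add0n; congr (_ ++ _).
  rewrite -[x in RHS]addn0 iotaDl; apply/eq_in_map => i; rewrite mem_iota /= => lt.
  by rewrite nth_cat size_nseq lt nth_nseq lt addnC.
rewrite -[X in iota X]addn0 iotaDl -!map_comp; apply: eq_map => i /=.
by rewrite nth_cat size_nseq ltnNge leq_addr /= addKn addnA.
Qed.

Lemma size_block_partition N bs : size (block_partition N bs) = sumn bs.
Proof. by elim: bs N => //= b bs IH N; rewrite size_cat size_nseq IH. Qed.

Lemma block_partition_le N bs x : x \in block_partition N bs -> x <= N.
Proof.
elim: bs N => //= b bs IH N; rewrite mem_cat mem_nseq => /orP[/andP[_ /eqP->]|/IH]; lia.
Qed.

Lemma last_le_sumn bs : last 0 bs <= sumn bs.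
Proof.
by case: bs => //= b bs; elim: bs b => //= [b|c bs IH b]; [lia | have := IH c; lia].
Qed.

(** The rows of the last block have length [N - 2 * sumn bs + last 0 bs], so the second hypothesis
    says that the smallest part is positive. *)
Lemma block_partitionP N bs : all (leq 1) bs -> 2 * sumn bs < N + last 0 bs ->
  is_partition (block_partition N bs).
Proof.
move=> pos lt; rewrite /is_partition sorted_pairwise; last by move=> x y z /=; lia.
elim: bs N pos lt => //= b bs IH N /andP[b0 pos] lt.
have {IH} : pairwise geq (block_partition (N - 2 * b) bs) &&
    (0 \notin block_partition (N - 2 * b) bs).
  case: bs IH pos lt => // c bs IH pos lt; apply: IH => //.
  have := last_le_sumn (c :: bs); move: lt => /=; lia.
move=> /andP[pw n0]; rewrite pairwise_cat pw mem_cat negb_or n0 andbT.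
rewrite mem_nseq; apply/andP; split; last first.
  have : last b bs = if bs is [::] then b else last 0 bs by case: (bs).
  have := last_le_sumn bs.
  by rewrite b0 /=; case: (bs) lt => /= [|c bs']; lia.
apply/andP; split.
  apply/allrelP => x y; rewrite mem_nseq => /andP[_ /eqP ->] /block_partition_le /=; lia.
by move: (N - b) => y; elim: (b) => //= n ->; rewrite andbT all_nseq /= leqnn orbT.
Qed.

(** A first block of [b] rows of length [N - b] takes the ends from [N - b] to [N - 1]. The other
    ends must stay below [N - b], hence below [N - 2 * b] once their rows are renumbered from 0;
    this is why the recursion continues with [N - 2 * b]. *)
Lemma ends_block_partition N bs : 2 * sumn bs <= N + last 0 bs ->
  perm_eq (ends (block_partition N bs)) (iota (N - sumn bs) (sumn bs)).
Proof.
elim: bs N => //= b bs IH N lt; rewrite ends_block.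
have lt' : 2 * sumn bs <= N - 2 * b + last 0 bs.
  by have := last_le_sumn bs; case: (bs) lt => //= c bs'; lia.
have -> : iota (N - (b + sumn bs)) (b + sumn bs) =
    iota (N - (b + sumn bs)) (sumn bs) ++ iota (N - b) b.
  rewrite addnC iotaD; congr (_ ++ iota _ _).
  by have := last_le_sumn bs; case: (bs) lt => /= [|c bs']; lia.
rewrite perm_catC perm_cat2r.
apply: (perm_trans (perm_map (addn b) (IH _ lt'))).
rewrite -iotaDl; case: (bs) lt lt' => // c bs' lt lt'.
have := last_le_sumn (c :: bs') => h.
have -> : b + (N - 2 * b - sumn (c :: bs')) = N - (b + sumn (c :: bs')).
  by move: lt h => /=; lia.
exact: perm_refl.
Qed.

Lemma block_partition_rcons N bs b :
  block_partition N (rcons bs b) = block_partition N bs ++ nseq b (N - 2 * sumn bs - b).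
Proof.
elim: bs N => [|c bs IH] N /=; first by rewrite cats0 muln0 subn0.
by rewrite IH -catA mulnDr subnDA.
Qed.

Lemma block_partition_gt N bs x : all (leq 1) bs -> 2 * sumn bs <= N ->
  x \in block_partition N bs -> N - 2 * sumn bs < x.
Proof.
elim: bs N => //= b bs IH N /andP[b0 pos] le.
rewrite mem_cat mem_nseq => /orP[/andP[_ /eqP->]|/(IH _ pos)]; first lia.
by rewrite mulnDr subnDA; apply; lia.
Qed.

(** The first part [N - b] determines [b]; the bounds keep this subtraction from being truncated. *)
Lemma block_partition_inj N bs bs' :
  all (leq 1) bs -> all (leq 1) bs' -> 2 * sumn bs <= N + last 0 bs ->
  2 * sumn bs' <= N + last 0 bs' ->
  block_partition N bs = block_partition N bs' -> bs = bs'.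
Proof.
elim: bs N bs' => [|b bs IH] N [|b' bs'] //=.
- by move=> _ /andP[b0 _] _ _ /(congr1 size); rewrite size_cat size_nseq /=; lia.
- by move=> /andP[b0 _] _ _ _ /(congr1 size); rewrite size_cat size_nseq /=; lia.
move=> /andP[b0 p] /andP[b0' p'] le le' e.
have bb : b = b'.
  move/(congr1 (nth 0 ^~ 0)): e; rewrite !nth_cat !size_nseq !nth_nseq b0 b0'.
  have := last_le_sumn bs; have := last_le_sumn bs'.
  by case: (bs) le => /= [|? ?]; case: (bs') le' => /= [|? ?]; lia.
subst b'; congr (_ :: _); apply: (IH (N - 2 * b)) => //.
- by have := last_le_sumn bs; case: (bs) le => //= c bs1; lia.
- by have := last_le_sumn bs'; case: (bs') le' => //= c bs1; lia.
by move/eqP: e; rewrite eqseq_cat // => /andP[_ /eqP].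
Qed.

Lemma sorted_nth_geq P i j : sorted geq P -> i <= j -> nth 0 P j <= nth 0 P i.
Proof.
move=> sP le; case: (ltnP j (size P)) => lt; last by rewrite nth_default.
have tr : transitive geq by move=> x y z /=; lia.
have rf : reflexive geq by move=> x /=.
by apply: (sorted_leq_nth tr rf 0 sP i j); rewrite ?inE //; lia.
Qed.

Lemma block_partition_of_ends N P : is_partition P -> size P <= N ->
  perm_eq (ends P) (iota (N - size P) (size P)) ->
  exists2 bs, composition (size P) bs & P = block_partition N bs.
Proof.
move: {2}(size P) (leqnn (size P)) => n.
elim: n N P => [|n IH] N P.
  by rewrite leqn0 => /nilP P0 _ _ _; exists [::]; rewrite P0.
move=> szP isP; have /andP[sP P0] := isP => leN pe.
have [P_nil|sz0] := posnP (size P); first by move/eqP/nilP: P_nil => ->; exists [::].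
have eU : uniq (ends P) by rewrite (perm_uniq pe) iota_uniq.
have e_inj i j : i < size P -> j < size P -> i + nth 0 P i = j + nth 0 P j -> i = j.
  move=> li lj; rewrite -!nth_ends // => /eqP.
  by rewrite nth_uniq ?size_ends // => /eqP.
have e_rng i : i < size P -> N - size P <= i + nth 0 P i < N.
  move=> li; have : i + nth 0 P i \in ends P by rewrite -nth_ends // mem_nth ?size_ends.
  by rewrite (perm_mem pe) mem_iota subnK.
pose x := nth 0 P 0; pose c := find (predC1 x) P.
have ltc i : i < c -> nth 0 P i = x by move/(before_find 0) => /negbFE/eqP.
have c0 : 0 < c by rewrite /c /x; case: (P) sz0 => //= y P' _; rewrite eqxx.
have cle : c <= size P by apply: find_size.
(* From one row to the next an end rises by at most one. Row [c] is shorter than [x], so its end is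
   at most [x + c - 1], and the ends from [x] to [x + c - 1] belong to the first [c] rows. After
   that, an end could leave the range below [x] only by equalling [x], the end of row 0. *)
have e_small i : c <= i < size P -> i + nth 0 P i < x.
  elim: i => [|i IHi] /andP[ci li]; first lia.
  have [ci'|] := leqP c i.
    have lx := IHi (introT andP (conj ci' (ltnW li))).
    have := sorted_nth_geq sP (leqnSn i) => le1.
    have ne : i.+1 + nth 0 P i.+1 <> 0 + nth 0 P 0 by move/(e_inj _ _ li sz0).
    by rewrite -/x in ne; lia.
  move=> ic; have ec : c = i.+1 by lia.
  have : nth 0 P c != x by apply: (nth_find 0 (a := predC1 x)); rewrite has_find -/c ec.
  have := sorted_nth_geq sP (leq0n c); rewrite -/x -ec => le1 ne1.
  rewrite ltnNge; apply/negP => ge.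
  have ltx : c + nth 0 P c - x < c by lia.
  have := e_inj c (c + nth 0 P c - x); rewrite (ltc _ ltx).
  by lia.
(* The first block ends at [x + c - 1] and all later ends are below [x]; the largest end is
   [N - 1]. *)
have ec : c = N - x.
  have h1 : N - size P <= c.-1 + x < N by rewrite -(ltc c.-1); [apply: e_rng|]; lia.
  have [lt|] := ltnP (x + c) N; last by lia.
  have : x + c \in ends P.
    by have := e_rng 0 sz0; rewrite (perm_mem pe) mem_iota -/x; lia.
  move=> /mapP[i]; rewrite mem_iota /= add0n => li.
  have [lic|ge] := ltnP i c; first by rewrite (ltc _ lic); lia.
  by have := e_small i; rewrite ge li /=; lia.
have eP : P = nseq c x ++ drop c P.
  rewrite -{1}(cat_take_drop c P); congr (_ ++ _).
  apply: (@eq_from_nth _ 0); rewrite size_takel ?size_nseq // => i lt.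
  by rewrite nth_take // nth_nseq lt ltc.
have x_rng := e_rng 0 sz0; rewrite -/x add0n in x_rng.
have ex : x = N - c by lia.
have szd : size (drop c P) = size P - c by rewrite size_drop.
have pe' : perm_eq (map (addn c) (ends (drop c P))) (iota (N - size P) (size P - c)).
  move: pe; rewrite {1}eP ends_block; have -> : iota (N - size P) (size P) =
      iota (N - size P) (size P - c) ++ iota x c.
    by rewrite -{2}(subnK cle) iotaD; congr (_ ++ iota _ _); lia.
  by rewrite perm_catC perm_cat2r.
have [szc|szc] := posnP (size P - c).
  exists [:: c]; first by rewrite /composition /= c0; lia.
  by rewrite /= cats0 -ex {1}eP drop_oversize ?cats0 //; lia.
(* The smallest end belongs to a row after the block, hence is at least [c]; so the remaining rows
   number at most [N - 2 * c]. *)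
have hN : c <= N - size P.
  have : N - size P \in map (addn c) (ends (drop c P)).
    by rewrite (perm_mem pe') mem_iota; lia.
  by case/mapP => y _ ->; lia.
have [|||| bs /andP[pos /eqP sb] eb] := IH (N - 2 * c) (drop c P).
- by rewrite szd; lia.
- rewrite /is_partition drop_sorted //; apply: contra P0; exact: mem_drop.
- by rewrite szd; lia.
- rewrite szd; apply: (perm_map_inj (f := addn c)); first exact: addnI.
  rewrite -iotaDl; have -> : c + (N - 2 * c - (size P - c)) = N - size P by lia.
  by [].
exists (c :: bs); first by rewrite /composition /= c0 pos sb szd; lia.
by rewrite /= -eb -ex.
Qed.

(** Row [r] meets diagonal [t] when [r <= t] and its end exceeds [t]. There are [minn t.+1 (size P)]
    rows with [r <= t], and those missing the diagonal are the rows whose end is at most [t]. *)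
Lemma diag_length_ends P t :
  diag_length P t + count (fun e => e <= t) (ends P) = minn t.+1 (size P).
Proof.
have row (r m : nat) : (\sum_(c < m) (r + c == t)) = (r <= t) && (t < r + m) :> nat.
  elim: m => [|m IH]; first by rewrite big_ord0 addn0; lia.
  by rewrite big_ord_recr /= IH; lia.
rewrite /diag_length /ends count_map -sum1_count.
rewrite -[X in iota 0 X]subn0 -/(index_iota 0 (size P)) big_mkord.
rewrite [X in _ + X]big_mkcond -big_split /=.
rewrite (eq_bigr (fun r : 'I_(size P) => nat_of_bool (r <= t))); last first.
  by move=> r _; rewrite row; case: ifP; lia.
elim: (size P) => [|m IH]; first by rewrite big_ord0; lia.
by rewrite big_ord_recr /= IH; lia.
Qed.

End Combinatorics.

(** * Partitions of diagonal lengths T *)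

Section Combinatorics2.
Local Open Scope nat_scope.

Lemma perm_eq_of_counts (s t : seq nat) :
  (forall n, count (fun e => e <= n) s = count (fun e => e <= n) t) -> perm_eq s t.
Proof.
have D n u : count (fun e => e <= n.+1) u = count_mem n.+1 u + count (fun e => e <= n) u.
  by elim: u => //= x u ->; move: (count _ u) (count _ u) => A B; lia.
move=> H; apply/allP => /= [[|n]] _; apply/eqP.
  have E u : count_mem 0 u = count (fun e => e <= 0) u by apply: eq_count => x /=; lia.
  by rewrite !E.
by have := H n.+1; rewrite !D H => /addIn.
Qed.

Lemma count_leq_iota n a m : count (fun e => e <= n) (iota a m) = minn m (n.+1 - a).
Proof. by elim: m => [|m IH]; rewrite ?min0n // -addn1 iotaD count_cat IH /=; lia. Qed.

Variables d k : nat.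
Hypotheses (hd : 1 <= d) (hk : 1 <= k).
Let N := 2 * d + k - 1.

(** The identity of [diag_length_ends] for the ends [N - s], ..., [N - 1]: for both values of [s] it
    yields the same sequence [T]. *)
Lemma hilbT_ends s t : s = d \/ s = d + k - 1 ->
  hilbT d k t + minn s (t.+1 - (N - s)) = minn t.+1 s.
Proof.
rewrite /hilbT /socle_degree /N => -[->|->]; (case: ifP => h1; last case: ifP => h2); lia.
Qed.

(** For a fixed number of rows, the diagonal lengths amount to the numbers of ends at most [t], and
    these determine the ends up to order. *)
Lemma diag_lengths_T P : size P = d \/ size P = d + k - 1 ->
  (forall i, diag_length P i = hilbT d k i) <->
  perm_eq (ends P) (iota (N - size P) (size P)).
Proof.
move=> hs; split=> [H|pe t].
  apply: perm_eq_of_counts => t; have := diag_length_ends P t.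
  by rewrite -(hilbT_ends t hs) H count_leq_iota => /addnI.
have := diag_length_ends P t; rewrite -(hilbT_ends t hs) (permP pe) count_leq_iota.
exact: addIn.
Qed.

Definition has_type_T s P :=
  [/\ is_partition P, forall i, diag_length P i = hilbT d k i & size P = s].

Lemma composition_last n bs : 0 < n -> composition n bs ->
  exists bs' b, [/\ bs = rcons bs' b, 0 < b, all (leq 1) bs' & sumn bs' + b = n].
Proof.
move=> n0 /andP[pos /eqP sb].
case: (lastP bs) pos sb => [|bs' b]; first by move=> _ /= e; rewrite -e in n0.
by rewrite all_rcons sumn_rcons => /andP[b0 p] e; exists bs', b; split.
Qed.

Lemma type_T_d P :
  has_type_T d P <-> exists2 bs, composition d bs & P = block_partition N bs.
Proof.
split=> [[isP /diag_lengths_T pe sP]|[bs cb ->]].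
  by rewrite -sP; apply: block_partition_of_ends; rewrite ?pe ?sP ?/N; auto; lia.
have [bs' [b [ebs b0 _ _]]] := composition_last hd cb.
have /andP[pos /eqP sb] := cb.
have lb : 0 < last 0 bs by rewrite ebs last_rcons.
have sz : size (block_partition N bs) = d by rewrite size_block_partition.
split=> //; first by apply: block_partitionP; rewrite // sb /N; lia.
apply/diag_lengths_T; first by left.
by rewrite sz -sb; apply: ends_block_partition; rewrite sb /N; lia.
Qed.

(** With [d + k - 1] rows, a last block of [b] rows has length [b + 1 - k], which is positive
    exactly when [k <= b]. With [d] rows the corresponding length is [b + k - 1], and no condition
    arises. *)
Lemma type_T_dk P :
  has_type_T (d + k - 1) P <->
  exists bs, [/\ composition (d + k - 1) bs, k <= last 0 bs & P = block_partition N bs].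
Proof.
have dk : 0 < d + k - 1 by lia.
split=> [[isP /diag_lengths_T pe sP]|[bs [cb lb ->]]].
  have [||bs cb eP] := block_partition_of_ends (N := N) isP.
  - by rewrite sP /N; lia.
  - by rewrite pe ?sP; auto.
  rewrite sP in cb; exists bs; split=> //.
  have [bs' [b [ebs b0 _ sb]]] := composition_last dk cb.
  move: isP; rewrite eP ebs block_partition_rcons last_rcons => /andP[_].
  rewrite mem_cat negb_or mem_nseq b0 => /andP[_] /=; rewrite /N; lia.
have [bs' [b [ebs b0 _ _]]] := composition_last dk cb.
have /andP[pos /eqP sb] := cb.
have sz : size (block_partition N bs) = d + k - 1 by rewrite size_block_partition.
split=> //; first by apply: block_partitionP; rewrite // sb /N; lia.
apply/diag_lengths_T; first by right.
by rewrite sz -sb; apply: ends_block_partition; rewrite sb /N; lia.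
Qed.

(** Here [a = b - 1]. The last block is a rectangle of [b] rows of length [b + k - 1], and
    [iota_part] transposes it. By [block_partition_gt] all other parts are larger, so the filter
    removes exactly this block. *)
Lemma iota_part_block bs b : all (leq 1) bs -> 0 < b -> sumn bs + b = d ->
  let P := block_partition N (rcons bs b) in
  [/\ smallest_part P = b + k - 1, count_mem (b + k - 1) P = b &
      iota_part k P = block_partition N (rcons bs (b + k - 1))].
Proof.
move=> pos b0 sb P.
have ex : N - 2 * sumn bs - b = b + k - 1 by rewrite /N; lia.
have eP : P = block_partition N bs ++ nseq b (b + k - 1).
  by rewrite /P block_partition_rcons ex.
have sm : smallest_part P = b + k - 1.
  rewrite eP /smallest_part; move: (b + k - 1) => x.
  by case: (b) b0 => // n _; rewrite last_cat /=; elim: n.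
have ne x : x \in block_partition N bs -> x != b + k - 1.
  move/(block_partition_gt pos); rewrite neq_ltn /N => h; apply/orP; right.
  by apply: leq_trans (h _); rewrite /N; lia.
have n0 : count_mem (b + k - 1) (block_partition N bs) = 0.
  by apply/count_memPn/negP => /ne; rewrite eqxx.
split=> //; first by rewrite eP count_cat n0 count_nseq /= eqxx mul1n.
rewrite /iota_part sm {1}eP filter_cat block_partition_rcons.
have -> : [seq p <- nseq b (b + k - 1) | p != b + k - 1] = [::].
  by move: (b + k - 1) => x; elim: (b) => //= n; rewrite eqxx.
have -> : [seq p <- block_partition N bs | p != b + k - 1] = block_partition N bs.
  by apply/all_filterP/allP => x /ne.
rewrite cats0; congr (_ ++ nseq _ _); rewrite /N; lia.
Qed.

Lemma type_T_d_iota P : has_type_T d P ->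
  (exists2 a, a <= d - 1 & smallest_part P = a + k /\ count_mem (a + k) P = a + 1)
  /\ has_type_T (d + k - 1) (iota_part k P).
Proof.
move=> /type_T_d[bs cb ->].
have [bs' [b [-> b0 p sb]]] := composition_last hd cb.
have [h1 h2 h3] := iota_part_block p b0 sb; split.
  exists (b - 1); first lia.
  have -> : b - 1 + k = b + k - 1 by lia.
  by split=> //; rewrite h2; lia.
apply/type_T_dk; exists (rcons bs' (b + k - 1)); split=> //; last by rewrite last_rcons; lia.
by rewrite /composition all_rcons sumn_rcons p; lia.
Qed.

Lemma iota_part_inj P Q : has_type_T d P -> has_type_T d Q ->
  iota_part k P = iota_part k Q -> P = Q.
Proof.
move=> /type_T_d[bs cb ->] /type_T_d[bs' cb' ->].
have [as_ [b [-> b0 p sb]]] := composition_last hd cb.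
have [as' [b' [-> b0' p' sb']]] := composition_last hd cb'.
have [_ _ ->] := iota_part_block p b0 sb; have [_ _ ->] := iota_part_block p' b0' sb'.
move/block_partition_inj; rewrite !all_rcons p p' !sumn_rcons !last_rcons !andbT.
rewrite /N; move=> H; have /rcons_inj[-> e] : rcons as_ (b + k - 1) = rcons as' (b' + k - 1).
  by apply: H; lia.
by congr (block_partition _ (rcons _ _)); lia.
Qed.

Lemma iota_part_surj Q : has_type_T (d + k - 1) Q ->
  exists2 P, has_type_T d P & iota_part k P = Q.
Proof.
move=> /type_T_dk[bs [cb lb ->]].
have dk : 0 < d + k - 1 by lia.
have [bs' [b [ebs b0 p sb]]] := composition_last dk cb.
rewrite ebs last_rcons in lb.
have [||h1 h2 h3] := iota_part_block (b := b + 1 - k) p; try lia.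
exists (block_partition N (rcons bs' (b + 1 - k))).
  apply/type_T_d; exists (rcons bs' (b + 1 - k)) => //.
  by rewrite /composition all_rcons sumn_rcons p; lia.
by rewrite h3 ebs; congr (block_partition _ (rcons _ _)); lia.
Qed.

(** The compositions of [n.+1], not of [n]. Their number doubles because raising the sum by one
    either puts a new part 1 in front or enlarges the first part. *)
Fixpoint compositions (n : nat) : seq (seq nat) :=
  if n is m.+1 then
    [seq 1 :: c | c <- compositions m] ++ [seq (head 0 c).+1 :: behead c | c <- compositions m]
  else [:: [:: 1]].

Lemma size_compositions n : size (compositions n) = 2 ^ n.
Proof. by elim: n => //= n IH; rewrite size_cat !size_map IH expnS mul2n addnn. Qed.

Lemma mem_compositions n c : (c \in compositions n) = composition n.+1 c.
Proof.
rewrite /composition; elim: n c => [|n IH] c.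
  rewrite inE; apply/eqP/andP => [->//|[]].
  case: c => //= b [|b' c] /=; first by move=> _ /eqP; rewrite addn0 => ->.
  by move=> /and3P[]; lia.
rewrite /= mem_cat; apply/orP/idP.
  case=> /mapP[c' + ->]; rewrite IH => /andP[h1 h2]; first by rewrite /= h1; lia.
  by case: c' h1 h2 => //= b c' /andP[_ ->]; lia.
case: c => [|[|[|b]] c] /andP[h1 h2] //; [left|right]; apply/mapP.
  by exists c => //; rewrite IH; move: h1 h2 => /= ->; lia.
by exists (b.+1 :: c) => //; rewrite IH; move: h1 h2 => /= ->; lia.
Qed.

Lemma compositions_uniq n : uniq (compositions n).
Proof.
elim: n => //= n IH; rewrite cat_uniq map_inj_uniq ?IH /=; last by move=> x y [].
rewrite map_inj_in_uniq ?IH ?andbT.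
  apply/hasPn => c /mapP[c' + ->]; rewrite mem_compositions.
  case: c' => [|[|b] c'] // _; apply/mapP => -[x _ []]; lia.
move=> [|b c] [|b' c'] //; rewrite !mem_compositions // => _ _ [-> ->] //.
Qed.

Lemma card_type_T_d : has_card (has_type_T d) (2 ^ (d - 1)).
Proof.
exists [seq block_partition N c | c <- compositions d.-1]; split.
- rewrite map_inj_in_uniq ?compositions_uniq // => c c'; rewrite !mem_compositions prednK //.
  move=> cb cb'; have [? [b [e b0 _ _]]] := composition_last hd cb.
  have [? [b' [e' b0' _ _]]] := composition_last hd cb'.
  move: cb cb' => /andP[h1 /eqP h2] /andP[h3 /eqP h4].
  by apply: block_partition_inj; rewrite ?h2 ?h4 //; rewrite /N ?e ?e' !last_rcons; lia.
- by rewrite size_map size_compositions subn1.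
move=> P; split=> [/mapP[c + ->]|/type_T_d[c cb ->]].
  by rewrite mem_compositions prednK // => cb; apply/type_T_d; exists c.
by apply: map_f; rewrite mem_compositions prednK.
Qed.

Lemma card_type_T_dk : has_card (has_type_T (d + k - 1)) (2 ^ (d - 1)).
Proof.
have [L [UL sL hL]] := card_type_T_d.
exists (map (iota_part k) L); split.
- by rewrite map_inj_in_uniq // => P Q /hL hP /hL hQ; apply: iota_part_inj.
- by rewrite size_map.
move=> Q; split=> [/mapP[P /hL hP ->]|/iota_part_surj[P /hL hP <-]]; last exact: map_f.
by have [] := type_T_d_iota hP.
Qed.

Lemma type_T_smallest P a : 
  has_type_T d P /\ smallest_part P = a + k <->
  exists bs, [/\ all (leq 1) bs, sumn bs + a.+1 = d & P = block_partition N (rcons bs a.+1)].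
Proof.
split=> [[/type_T_d[bs cb ->] sm]|[bs [p sb ->]]].
  have [bs' [b [ebs b0 p sb]]] := composition_last hd cb.
  have [h1 _ _] := iota_part_block p b0 sb.
  rewrite ebs h1 in sm; have eb : b = a.+1 by lia.
  by exists bs'; rewrite ebs -eb.
have [h1 _ _] := iota_part_block p (ltn0Sn a) sb; rewrite h1; split; last lia.
apply/type_T_d; exists (rcons bs a.+1) => //.
by rewrite /composition all_rcons sumn_rcons p; lia.
Qed.

(** The smallest part is [a + k] when the last block has [a.+1] rows. The preceding blocks then form
    an arbitrary composition of [d - 1 - a], a positive number. *)
Lemma card_smallest a : a.+2 <= d ->
  has_card (fun P => has_type_T d P /\ smallest_part P = a + k) (2 ^ (d - 2 - a)).
Proof.
move=> ad; exists [seq block_partition N (rcons c a.+1) | c <- compositions (d - 2 - a)].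
have cE : (d - 2 - a).+1 = d - a.+1 by lia.
split.
- rewrite map_inj_in_uniq ?compositions_uniq // => c c'; rewrite !mem_compositions cE.
  move=> /andP[h1 /eqP h2] /andP[h3 /eqP h4] /block_partition_inj.
  rewrite !all_rcons h1 h3 !sumn_rcons !last_rcons h2 h4 => /(_ isT isT) H.
  by have /rcons_inj[] : rcons c a.+1 = rcons c' a.+1 by apply: H; rewrite /N; lia.
- by rewrite size_map size_compositions.
move=> P; split=> [/mapP[c + ->]|/type_T_smallest[c [p sc ->]]].
  rewrite mem_compositions cE => /andP[p /eqP sc].
  by apply/type_T_smallest; exists c; split=> //; lia.
apply: map_f; rewrite mem_compositions cE /composition p; lia.
Qed.

Lemma unique_smallest : exists P : seq nat,
  unique (fun Q => has_type_T d Q /\ smallest_part Q = d + k - 1) P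
  /\ count_mem (d + k - 1) P = d.
Proof.
have e : d + k - 1 = d.-1 + k by lia.
have [_ h2 _] := iota_part_block (bs := [::]) (b := d) isT hd (add0n d).
exists (block_partition N [:: d]); split=> //; split=> [|Q]; rewrite e.
  by apply/type_T_smallest; exists [::]; split; rewrite ?prednK ?add0n //.
move=> /type_T_smallest[bs [p sb ->]].
have bs0 : sumn bs = 0 by lia.
have -> : bs = [::] by case: bs p bs0 {sb} => [|[|b] bs].
by rewrite prednK.
Qed.

End Combinatorics2.

(** * A complete intersection with a prescribed Jordan type *)

(** A nonzero multiple of [f] has degree at least [s], which the combination of the [p i] cannot
    reach, so [u = 0]; the remaining polynomials have distinct degrees. *)
Lemma triangular_free (K : fieldType) (p : nat -> {poly K}) (s : nat) (c : nat -> K)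
    (u f : {poly K}) :
  (forall i, size (p i) = i.+1) -> size f = s.+1 ->
  \sum_(i < s) c i *: p i + u * f = 0 -> forall i, (i < s)%N -> c i = 0.
Proof.
move=> szp szf e.
have szs m : (size (\sum_(i < m) c i *: p i)%R <= m)%N.
  apply: (leq_trans (size_sum _ _ _)); apply/bigmax_leqP => i _.
  by apply: (leq_trans (size_scale_leq _ _)); rewrite szp.
have u0 : u = 0.
  apply/eqP; apply/negPn/negP => nzu.
  have nzf : f != 0 by rewrite -size_poly_eq0 szf.
  have := szs s; have -> : \sum_(i < s) c i *: p i = - (u * f).
    by apply/eqP; rewrite -addr_eq0 e.
  rewrite size_polyN size_mul // szf; move: nzu; rewrite -size_poly_eq0.
  by move: (size u) => n; lia.
move: e; rewrite u0 mul0r addr0 => {u0}; elim: s {szf} => // s IH.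
rewrite big_ord_recr /= => e.
have cs : c s = 0.
  move/(congr1 (fun q : {poly K} => q`_s)): e; rewrite coefD coefZ coef0.
  rewrite (nth_default _ (szs s)) add0r => /eqP; rewrite mulf_eq0 => /orP[/eqP //|].
  have : lead_coef (p s) != 0 by rewrite lead_coef_eq0 -size_poly_eq0 szp.
  by rewrite lead_coefE szp /= => /negbTE->.
move: e; rewrite cs scale0r addr0 => /IH H i; rewrite ltnS leq_eqVlt => /orP[/eqP->//|].
exact: H.
Qed.

Lemma monomial2E (K : nzRingType) (m : 'X_{1..2}) :
  'X_[m] = 'X_(0 : 'I_2) ^+ m 0 * 'X_(1 : 'I_2) ^+ m 1 :> {mpoly K[2]}.
Proof.
rewrite {1}mpolyXE_id big_ord_recl big_ord1.
by have -> : lift ord0 ord0 = 1 :> 'I_2 by apply: val_inj.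
Qed.

(** * Substituting a constant for the first variable *)

Section Evaluation.
Variable K : fieldType.
Local Notation R := {mpoly K[2]}.

Definition subst_var (c : K) (i : 'I_2) : {poly K} := if i == 0 then c%:P else 'X.

(** Used with [c = 1] for dehomogenization and with [c = 0] for reduction modulo the first
    variable. *)
Definition subst_fst (c : K) (r : R) : {poly K} := mmap (@polyC K) (subst_var c) r.

Lemma subst_fstM c : {morph subst_fst c : a b / a * b}.
Proof. by move=> a b; rewrite /subst_fst rmorphM. Qed.

Lemma subst_fstB c : {morph subst_fst c : a b / a - b}.
Proof. by move=> a b; rewrite /subst_fst rmorphB. Qed.

Lemma subst_fstD c : {morph subst_fst c : a b / a + b}.
Proof. by move=> a b; rewrite /subst_fst rmorphD. Qed.

Lemma subst_fstXn c n : {morph subst_fst c : a / a ^+ n}.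
Proof. by move=> a; rewrite /subst_fst rmorphXn. Qed.

Lemma subst_fst0 c : subst_fst c 0 = 0.
Proof. by rewrite /subst_fst rmorph0. Qed.

Lemma subst_fst1 c : subst_fst c 1 = 1.
Proof. by rewrite /subst_fst rmorph1. Qed.

Lemma subst_fst_sum c (J : Type) (r : seq J) (Q : pred J) (F : J -> R) :
  subst_fst c (\sum_(j <- r | Q j) F j) = \sum_(j <- r | Q j) subst_fst c (F j).
Proof. by rewrite /subst_fst rmorph_sum. Qed.

Lemma subst_fstZ c a r : subst_fst c (a *: r) = a *: subst_fst c r.
Proof. by rewrite /subst_fst mmapZ mul_polyC. Qed.

Lemma subst_fst_X0 c : subst_fst c 'X_(0 : 'I_2) = c%:P.
Proof. by rewrite /subst_fst mmapX mmap1U. Qed.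

Lemma subst_fst_X1 c : subst_fst c 'X_(1 : 'I_2) = 'X.
Proof. by rewrite /subst_fst mmapX mmap1U. Qed.

Lemma subst_fst0_dvd r : subst_fst 0 r = 0 -> exists u, r = 'X_(0 : 'I_2) * u.
Proof.
(* A section of the substitution at 0: a monomial either contains the first variable or is recovered
   from its image. *)
pose lift_snd (q : {poly K}) : R := (map_poly (@mpolyC 2 K) q).['X_(1 : 'I_2)].
suff [u e] : exists u, r = 'X_(0 : 'I_2) * u + lift_snd (subst_fst 0 r).
  by move=> r0; exists u; rewrite {1}e r0 /lift_snd rmorph0 horner0 addr0.
rewrite {1 2}[r]mpolyE; elim/big_ind: _ => [|a b [u eu] [v ev]|m _].
- by exists 0; rewrite subst_fst0 /lift_snd rmorph0 horner0 mulr0 addr0.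
- exists (u + v); rewrite {1}eu {1}ev subst_fstD /lift_snd rmorphD hornerD mulrDr.
  by rewrite addrACA.
rewrite subst_fstZ monomial2E subst_fstM !subst_fstXn subst_fst_X0 subst_fst_X1.
case: (m 0) => [|n].
  exists 0; rewrite mulr0 add0r !expr0 !mul1r /lift_snd -mul_polyC rmorphM /=.
  by rewrite map_polyC map_polyXn hornerCM hornerXn mul_mpolyC.
exists (r@_m *: ('X_0 ^+ n * 'X_1 ^+ m 1)).
by rewrite expr0n /= mul0r scaler0 /lift_snd rmorph0 horner0 addr0 exprS -mulrA scalerAr.
Qed.

End Evaluation.

(** * The ideal attached to a partition and its strings *)

Section Construction.
Variables (K : fieldType) (P : seq nat) (N : nat).
Local Notation R := {mpoly K[2]}.
Local Notation s := (size P).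
Local Notation x := ('X_(0 : 'I_2) : R).
Local Notation y := ('X_(1 : 'I_2) : R).
Local Notation len u := (nth 0%N P u).
Hypotheses (isP : is_partition P) (s0 : (0 < s)%N) (hN : (s <= N)%N).
Hypothesis pe : perm_eq (ends P) (iota (N - s) s).

(** For the row of largest end [N - 1] the search fails and returns [s]; this exceeds the row, so
    the correction term in [row_polyS] is dropped. *)
Definition next_row (u : nat) : nat := index (u + len u).+1 (ends P).

Lemma len_gt0 u : (u < s)%N -> (0 < len u)%N.
Proof.
by case/andP: isP => _ P0 lt; rewrite lt0n; apply: contraNneq P0 => <-; apply: mem_nth.
Qed.

Lemma len_decr u w : (u <= w)%N -> (len w <= len u)%N.
Proof. by case/andP: isP => sP _; apply: sorted_nth_geq. Qed.

Lemma ends_range u : (u < s)%N -> (N - s <= u + len u < N)%N.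
Proof.
move=> lt; have : (u + len u)%N \in ends P by rewrite -nth_ends // mem_nth ?size_ends.
by rewrite (perm_mem pe) mem_iota subnK.
Qed.

Lemma ends_inj u w : (u < s)%N -> (w < s)%N -> (u + len u = w + len w)%N -> u = w.
Proof.
move=> lu lw; rewrite -!nth_ends // => /eqP.
by rewrite nth_uniq ?size_ends ?(perm_uniq pe) ?iota_uniq // => /eqP.
Qed.

Lemma row_of_end e : (N - s <= e < N)%N ->
  (index e (ends P) < s)%N /\ (index e (ends P) + len (index e (ends P)) = e)%N.
Proof.
move=> he; have ein : e \in ends P by rewrite (perm_mem pe) mem_iota subnK.
have lt : (index e (ends P) < s)%N by rewrite -(size_ends P) index_mem.
by split=> //; rewrite -nth_ends // nth_index.
Qed.

Definition first_row : nat := index (N - s)%N (ends P).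

Lemma first_rowP : (first_row < s)%N /\ (first_row + len first_row = N - s)%N.
Proof. by apply: row_of_end; lia. Qed.

Lemma len_size : len s = 0%N. Proof. by rewrite nth_default. Qed.

(* The ends increase by at most one from a row to the next, so a row after [u] whose
   end exceeds that of [u] can only be the row [u.+1], of the same length. *)
Lemma next_rowP u : (u < s)%N -> ((u + len u).+1 < N)%N ->
  [/\ (next_row u < s)%N, (next_row u + len (next_row u) = (u + len u).+1)%N &
      (next_row u <= u)%N /\ (len u.+1 < len u)%N \/
      next_row u = u.+1 /\ len u.+1 = len u].
Proof.
move=> lu lN.
have [h1 h2] : (next_row u < s)%N /\ (next_row u + len (next_row u) = (u + len u).+1)%N.
  by apply: row_of_end; have := ends_range lu; lia.
split=> //; set w := next_row u in h1 h2 *.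
have lw := len_decr (leqnSn u).
have [eq|ne] := eqVneq (len u.+1) (len u).
  right; split=> //; have us : (u.+1 < s)%N.
    rewrite ltnNge; apply/negP => ge; move: eq; rewrite nth_default //.
    by have := len_gt0 lu; lia.
  by apply: ends_inj => //; rewrite h2 eq.
left; split; last by lia.
rewrite leqNgt; apply/negP => lt.
have H v : (u < v < s)%N -> (v + len v < u + len u)%N.
  elim: v => // v IH /andP[uv vs].
  have nev : (v.+1 + len v.+1 <> u + len u)%N by move/(ends_inj vs lu); lia.
  have := len_decr (leqnSn v).
  have [uv'|vu] := ltnP u v; first by have := IH (introT andP (conj uv' (ltnW vs))); lia.
  have ev : v = u by lia.
  by subst v; lia.
by have := H w; rewrite lt h1 => /(_ isT); lia.
Qed.

(** The recursion refers back to an arbitrary earlier row, so the list of all earlier polynomials is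
    carried along. *)
Fixpoint row_poly_seq (n : nat) : seq R :=
  if n is m.+1 then
    let L := row_poly_seq m in
    rcons L (y * last 0 L -
      (if (next_row m <= m)%N then x ^+ (m.+1 - next_row m) * nth 0 L (next_row m) else 0))
  else [:: 1].

Definition row_poly (n : nat) : R := last 0 (row_poly_seq n).

Lemma size_row_poly_seq n : size (row_poly_seq n) = n.+1.
Proof. by elim: n => //= n IH; rewrite size_rcons IH. Qed.

Lemma nth_row_poly_seq n i : (i <= n)%N -> nth 0 (row_poly_seq n) i = row_poly i.
Proof.
elim: n => [|n IH]; first by rewrite leqn0 => /eqP ->.
rewrite leq_eqVlt => /orP[/eqP->|lt].
  by rewrite /row_poly /= last_rcons nth_rcons size_row_poly_seq ltnn eqxx.
by rewrite /= nth_rcons size_row_poly_seq lt IH.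
Qed.

Lemma row_polyS n : row_poly n.+1 = y * row_poly n -
  (if (next_row n <= n)%N then x ^+ (n.+1 - next_row n) * row_poly (next_row n) else 0).
Proof.
by rewrite {1}/row_poly /= last_rcons; case: ifP => // le; rewrite nth_row_poly_seq.
Qed.

Lemma row_poly_rec n : y * row_poly n = row_poly n.+1 +
  (if (next_row n <= n)%N then x ^+ (n.+1 - next_row n) * row_poly (next_row n) else 0).
Proof. by rewrite row_polyS subrK. Qed.

Lemma homog_var i : ('X_i : R) \is 1.-homog.
Proof. by rewrite dhomogX /= mdeg1. Qed.

Lemma homog_row_poly n : row_poly n \is n.-homog.
Proof.
elim/ltn_ind: n => -[_|n IH]; first exact: dhomog1.
rewrite row_polyS; apply: rpredB.
  exact: (dhomogM (homog_var 1) (IH n (ltnSn n))).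
case: ifP => le; last exact: dhomog0.
have := dhomogM (homog_exp (n.+1 - next_row n) (homog_var 0)) (IH _ le).
by rewrite subnK // leqW.
Qed.

Definition ci_f : R := row_poly s.
Definition ci_g : R :=
  x ^+ len first_row * row_poly first_row.
Definition ci_ideal : R -> Prop := ideal2 ci_f ci_g.

Lemma homog_ci_f : ci_f \is s.-homog. Proof. exact: homog_row_poly. Qed.

Lemma homog_ci_g : ci_g \is (N - s).-homog.
Proof.
have [_ <-] := first_rowP; rewrite addnC.
by apply: dhomogM (homog_row_poly _); apply/homog_exp/homog_var.
Qed.

Let idI : ideal_pred ci_ideal := ideal2_ideal ci_f ci_g.
Let hoI : forall n h, ci_ideal h -> ci_ideal (pihomog mdeg n h) :=
  ideal2_homog homog_ci_f homog_ci_g.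

Lemma ci_ideal_f : ci_ideal ci_f.
Proof. by exists 1, 0; rewrite mul1r mul0r addr0. Qed.

Lemma ci_ideal_g : ci_ideal ci_g.
Proof. by exists 0, 1; rewrite mul1r mul0r add0r. Qed.

Lemma row_killed u t : (u <= s)%N -> (len u <= t)%N -> ci_ideal (x ^+ t * row_poly u).
Proof.
move=> us le; rewrite -(subnK le) exprD -mulrA; apply: (idealM idI) => {t le}.
case: (ltnP u s) => [lt|ge]; last first.
  have -> : u = s by lia.
  by rewrite len_size mul1r; apply: ci_ideal_f.
(* Induction on the end, upwards from [first_row]: the row of end [N - s + m + 1] is the next row of
   the row [v] of end [N - s + m]. *)
suff H m w : (w < s)%N -> (w + len w <= N - s + m)%N -> ci_ideal (x ^+ len w * row_poly w).
  by apply: (H N) => //; have := ends_range lt; lia.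
elim: m w => [|m IH] w lw hw.
  have := ends_range lw; rewrite addn0 in hw => rg.
  have [lv ev] := first_rowP.
  have -> : w = first_row by apply: ends_inj => //; lia.
  exact: ci_ideal_g.
have [le|gt] := leqP (w + len w) (N - s + m); first exact: IH.
have [|lv ev] := @row_of_end (N - s + m)%N; first by have := ends_range lw; lia.
set v := index _ _ in lv ev.
have [] := next_rowP lv; first by have := ends_range lw; lia.
set nv := next_row v => lnv env.
have -> : w = nv by apply: ends_inj => //; lia.
have Iv : ci_ideal (x ^+ len v * row_poly v) by apply: IH => //; lia.
case=> [[le lt']|[env' elen]].
  (* The two ends differ by one, which is exactly what makes the exponents in the recursion for [v]
     match. *)
  have -> : len nv = (len v + (v.+1 - nv))%N by lia.
  have -> : x ^+ (len v + (v.+1 - nv)) * row_poly nv =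
      y * (x ^+ len v * row_poly v) -
      x ^+ (len v - len v.+1) * (x ^+ len v.+1 * row_poly v.+1).
    rewrite [y * _]mulrCA row_poly_rec -/nv le [X in _ - X]mulrA -exprD subnK; last by lia.
    by rewrite mulrDr [_ + x ^+ _ * _]addrC addrK mulrA -exprD.
  apply: (idealB idI); apply: (idealM idI) => //.
  have [vs|vs] := ltnP v.+1 s; first by apply: IH => //; lia.
  have -> : v.+1 = s by lia.
  by rewrite len_size mul1r; apply: ci_ideal_f.
(* Inside a block of equal rows there is no correction term: [row_poly v.+1] is [y * row_poly v]. *)
rewrite env' elen row_polyS -/nv env' ltnn subr0 mulrCA.
exact: (idealM idI).
Qed.

Definition ci_strings : seq (R * nat) := [seq (row_poly i, len i) | i <- iota 0 s].

Lemma nth_ci_strings i : (i < s)%N -> nth (0%R, 0%N) ci_strings i = (row_poly i, len i).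
Proof. by move=> lt; rewrite (nth_map 0%N) ?size_iota // nth_iota. Qed.

Lemma mem_ci_idx i t :
  ((i, t) \in string_idx ci_strings) = (i < s)%N && (t < len i)%N.
Proof.
rewrite mem_string_idx size_map size_iota; case: ltnP => // lt.
by rewrite nth_ci_strings.
Qed.

Lemma ci_string_vec i t : (i < s)%N -> string_vec x ci_strings (i, t) = x ^+ t * row_poly i.
Proof. by move=> lt; rewrite /string_vec nth_ci_strings. Qed.

Lemma homog_ci_string_vec p : p \in string_idx ci_strings ->
  string_vec x ci_strings p \is (p.1 + p.2).-homog.
Proof.
case: p => i t; rewrite mem_ci_idx => /andP[lt _].
apply: (homog_string_vec (homog_var 0) (D := id)); rewrite nth_ci_strings //.
exact: homog_row_poly.
Qed.

(** The span contains 1 and is stable under both variables: [row_poly_rec] expresses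
    [y * row_poly i] through rows of index at most [i.+1 <= s], and powers of [x] too long for their
    row lie in the ideal. *)
Lemma ci_span r : spanI ci_ideal (string_idx ci_strings) (string_vec x ci_strings) r.
Proof.
have U := string_idx_uniq ci_strings.
pose S r := spanI ci_ideal (string_idx ci_strings) (string_vec x ci_strings) r.
have Srow t i : (i <= s)%N -> S (x ^+ t * row_poly i).
  move=> is_; have [lt|ge] := ltnP t (len i); last by apply: spanI_ideal; apply: row_killed.
  have lts : (i < s)%N.
    by rewrite ltnNge; apply/negP => ge; rewrite nth_default in lt.
  by rewrite -ci_string_vec //; apply: spanI_mem => //; rewrite mem_ci_idx lts.
have Sx r1 : S r1 -> S (x * r1).
  move/(spanI_mull idI); apply=> -[i t]; rewrite mem_ci_idx => /andP[lt _].
  by rewrite ci_string_vec // mulrA -exprS; apply: Srow; apply: ltnW.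
have Sy r1 : S r1 -> S (y * r1).
  move/(spanI_mull idI); apply=> -[i t]; rewrite mem_ci_idx => /andP[lt _].
  rewrite ci_string_vec // mulrCA row_poly_rec mulrDr; apply: spanID => //; first exact: Srow.
  case: ifP => le; last by rewrite mulr0; apply: spanI_ideal; apply: ideal0.
  by rewrite mulrA -exprD; apply: Srow; lia.
have SX z n r1 : (forall r1, S r1 -> S (z * r1)) -> S r1 -> S (z ^+ n * r1).
  by move=> hz h; elim: n => [|n IH]; rewrite ?mul1r // exprS -mulrA; apply: hz.
rewrite [r]mpolyE; apply: spanI_sum => // m _; apply: spanIZ => //.
have -> : 'X_[m] = x ^+ m 0 * (y ^+ m 1 * 1) by rewrite mulr1 monomial2E.
apply: (SX x _ _ Sx); apply: (SX y _ _ Sy).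
by have := Srow 0%N 0%N (leq0n _); rewrite mul1r.
Qed.

(** * Independence of the strings by dehomogenization *)

Local Notation dehom := (@subst_fst K 1).

Lemma dehom_row_poly n : dehom (row_poly n.+1) = 'X * dehom (row_poly n) -
  (if (next_row n <= n)%N then dehom (row_poly (next_row n)) else 0).
Proof.
rewrite row_polyS subst_fstB subst_fstM subst_fst_X1; congr (_ - _).
by case: ifP; rewrite ?subst_fst0 // subst_fstM subst_fstXn subst_fst_X0 expr1n mul1r.
Qed.

Lemma size_dehom_row_poly n : size (dehom (row_poly n)) = n.+1.
Proof.
elim/ltn_ind: n => -[_|n IH]; first by rewrite subst_fst1 size_poly1.
have szX : size ('X * dehom (row_poly n)) = n.+2.
  by rewrite mulrC size_mulX ?IH // -size_poly_eq0 IH.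
rewrite dehom_row_poly size_polyDl // szX size_polyN.
by case: ifP => le; rewrite ?size_poly0 // IH.
Qed.

(* Setting [x = 1] identifies the forms of degree [n] with the polynomials of degree at
   most [n]; this subspace contains the image of the degree [n] part of the ideal. *)
Inductive dehom_span (n : nat) : {poly K} -> Prop :=
  | Dehom_row i of (i < s)%N & (i + len i <= n)%N : dehom_span n (dehom (row_poly i))
  | Dehom_f u : dehom_span n (u * dehom ci_f)
  | Dehom_add p q of dehom_span n p & dehom_span n q : dehom_span n (p + q)
  | Dehom_scale a p of dehom_span n p : dehom_span n (a *: p).

Lemma dehom_span0 n : dehom_span n 0.
Proof. by rewrite -(mul0r (dehom ci_f)); apply: Dehom_f. Qed.

Lemma dehom_span_mono n m p : (n <= m)%N -> dehom_span n p -> dehom_span m p.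
Proof.
move=> le; elim=> [i lt h|u|q r _ h1 _ h2|a q _ h].
- by apply: Dehom_row => //; apply: leq_trans le.
- exact: Dehom_f.
- exact: Dehom_add.
- exact: Dehom_scale.
Qed.

(** Multiplying by ['X] raises ends by at most one: row [i.+1] ends at most one after row [i], and
    [next_row i] exactly one after it. *)
Lemma dehom_spanX n p : dehom_span n p -> dehom_span n.+1 ('X * p).
Proof.
elim=> [i lt h|u|q r _ h1 _ h2|a q _ h].
- have -> : 'X * dehom (row_poly i) = dehom (row_poly i.+1) +
      (if (next_row i <= i)%N then dehom (row_poly (next_row i)) else 0).
    by rewrite dehom_row_poly subrK.
  apply: Dehom_add.
    have [lt'|ge] := ltnP i.+1 s.
      by apply: Dehom_row => //; have := len_decr (leqnSn i); lia.
    have -> : i.+1 = s by lia.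
    by rewrite -[dehom _]mul1r; apply: Dehom_f.
  case: ifP => le; last exact: dehom_span0.
  apply: Dehom_row; first exact: leq_ltn_trans le lt.
  have [lN|] := ltnP (i + len i).+1 N; first by have [_ -> _] := next_rowP lt lN.
  move=> ge; have := ends_range (leq_ltn_trans le lt); lia.
- by rewrite mulrA; apply: Dehom_f.
- by rewrite mulrDr; apply: Dehom_add.
- by rewrite -scalerAr; apply: Dehom_scale.
Qed.

Lemma dehom_spanXn n k p : dehom_span n p -> dehom_span (n + k) ('X^k * p).
Proof.
move=> h; elim: k => [|k IH]; first by rewrite addn0 mul1r.
by rewrite exprS -mulrA addnS; apply: dehom_spanX.
Qed.

Lemma dehom_spanE n p : dehom_span n p -> exists (c : nat -> K) u,
  p = \sum_(i < s | (i + len i <= n)%N) c i *: dehom (row_poly i) + u * dehom ci_f.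
Proof.
elim=> [i lt h|u|q r _ [c1 [u1 ->]] _ [c2 [u2 ->]]|a q _ [c [u ->]]].
- exists (fun j => (j == i)%:R), 0; rewrite mul0r addr0 (bigD1 (Ordinal lt)) //= eqxx scale1r.
  rewrite big1 ?addr0 // => j /andP[_ ne].
  by have /negbTE-> : (nat_of_ord j != i) by []; rewrite scale0r.
- by exists (fun=> 0), u; rewrite big1 ?add0r // => j _; rewrite scale0r.
- exists (fun i => c1 i + c2 i), (u1 + u2); rewrite mulrDl addrACA -big_split /=.
  by under eq_bigr do rewrite -scalerDl.
- exists (fun i => a * c i), (a *: u); rewrite scalerDr scalerAl scaler_sumr.
  by under eq_bigr do rewrite scalerA.
Qed.

Lemma dehom_ci_ideal n h : h \is n.-homog -> ci_ideal h -> dehom_span n (dehom h).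
Proof.
move=> hn [u [w eh]]; rewrite -(pihomog_dE hn) eh linearD /= subst_fstD.
apply: Dehom_add.
  have [u' ->] := pihomog_mul_homog n u homog_ci_f.
  by rewrite subst_fstM; apply: Dehom_f.
(* In degree [n] only monomials of degree [n - (N - s)] multiply [ci_g]. At [x = 1] such a product
   is a power of ['X] times the polynomial of [first_row], whose end is [N - s]. *)
rewrite [w]mpolyE mulr_suml linear_sum subst_fst_sum.
elim/big_ind: _ => [||m _]; [exact: dehom_span0 | exact: Dehom_add |].
rewrite -scalerAl linearZ /= subst_fstZ; apply: Dehom_scale.
have hm : 'X_[m] * ci_g \is (mdeg m + (N - s)).-homog.
  by apply: dhomogM homog_ci_g; rewrite dhomogX.
have [en|/eqP ne] := (mdeg m + (N - s))%N =P n; last first.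
  by rewrite (pihomog_ne0 ne hm) subst_fst0; apply: dehom_span0.
rewrite -en (pihomog_dE hm) subst_fstM monomial2E subst_fstM !subst_fstXn.
rewrite subst_fst_X0 subst_fst_X1 expr1n mul1r.
have hmd : (m 1%R <= mdeg m)%N.
  rewrite mdegE big_ord_recl big_ord1.
  by have -> : lift ord0 ord0 = 1 :> 'I_2 by [apply: val_inj]; apply: leq_addl.
apply: (@dehom_span_mono (N - s + m 1%R)); first by lia.
apply: dehom_spanXn; rewrite /ci_g subst_fstM subst_fstXn subst_fst_X0 expr1n mul1r.
have [lv ev] := first_rowP.
by apply: Dehom_row => //; rewrite ev.
Qed.

Lemma ci_free : freeI ci_ideal (string_idx ci_strings) (string_vec x ci_strings).
Proof.
apply: (@freeI_of_graded _ _ idI hoI _ _ _ (fun p => (p.1 + p.2)%N)).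
  exact: homog_ci_string_vec.
move=> n c; set fl := filter _ _ => Ic [i0 t0] it0.
have flP i t : (i, t) \in fl = [&& (i + t == n)%N, (i < s)%N & (t < len i)%N].
  by rewrite mem_filter mem_ci_idx.
have := dehom_ci_ideal _ Ic => /(_ n) H.
have {}/H H : \sum_(j <- fl) c j *: string_vec x ci_strings j \is n.-homog.
  rewrite big_seq; apply: rpred_sum => -[i t]; rewrite flP => /and3P[/eqP<- lt _].
  apply: rpredZ; rewrite ci_string_vec // addnC.
  exact: dhomogM (homog_exp _ (homog_var 0)) (homog_row_poly i).
have [b [u e]] := dehom_spanE H.
pose a i := if (i <= n)%N && (n < i + len i)%N then c (i, n - i)%N else 0.
have ea : dehom (\sum_(j <- fl) c j *: string_vec x ci_strings j) =
    \sum_(i < s) a i *: dehom (row_poly i).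
  rewrite subst_fst_sum.
  rewrite (perm_big [seq (i, n - i)%N | i <- iota 0 s & (i <= n)%N && (n < i + len i)%N]).
    rewrite big_map big_filter big_mkcond /=.
    rewrite -[X in iota 0 X]subn0 big_mkord; apply: eq_bigr => i _; rewrite /a.
    case: ifP => _; last by rewrite scale0r.
    by rewrite subst_fstZ ci_string_vec // subst_fstM subst_fstXn subst_fst_X0 expr1n mul1r.
  apply: uniq_perm; first by rewrite filter_uniq ?string_idx_uniq.
    by rewrite map_inj_uniq ?filter_uniq ?iota_uniq // => i j [].
  move=> [i t]; rewrite flP; apply/and3P/mapP => [[h1 h2 h3]|[j]].
    exists i; last by congr pair; lia.
    by rewrite mem_filter mem_iota; lia.
  by rewrite mem_filter mem_iota => hj [-> ->]; split; lia.
(* [a] is supported on rows with [i <= n < i + len i], and the terms in [b] on rows of end at most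
   [n]. The supports are disjoint, so nothing cancels and the vanishing of [a'] gives that of
   [c]. *)
pose a' i := a i - (if (i + len i <= n)%N then b i else 0).
have := it0; rewrite flP => /and3P[h1 h2 h3].
suff : a' i0 = 0.
  rewrite /a' /a ifT; last by lia.
  rewrite ifF; last by lia.
  by rewrite subr0; have -> : (n - i0 = t0)%N by lia.
apply: (triangular_free (p := fun i => dehom (row_poly i)) (f := dehom ci_f)
  (u := - u) (s := s)) => //.
- exact: size_dehom_row_poly.
- exact: size_dehom_row_poly.
under eq_bigr do rewrite scalerBl.
rewrite sumrB -ea e mulNr; set A := \sum_(i < s | _) _; set B := \sum_(i < s) _.
have -> : B = A.
  by rewrite /A big_mkcond /=; apply: eq_bigr => i _; case: ifP; rewrite ?scale0r.
by rewrite [A + _]addrC addrK subrr.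
Qed.

Lemma ci_string_decomposition : string_decomposition ci_ideal x ci_strings.
Proof.
apply/string_decompositionE; split; [|exact: ci_free|exact: ci_span].
move=> g /mapP[i]; rewrite mem_iota /= => lt ->; split; first exact: len_gt0.
by apply: row_killed => //; apply: ltnW.
Qed.

Lemma ci_f_neq0 : ci_f != 0.
Proof.
apply/eqP => f0; have := size_dehom_row_poly s.
by rewrite -[row_poly s]/ci_f f0 subst_fst0 size_poly0.
Qed.

Lemma subst0_row_poly n : subst_fst 0 (row_poly n) = 'X^n.
Proof.
elim: n => [|n IH]; first exact: subst_fst1.
rewrite row_polyS subst_fstB subst_fstM subst_fst_X1 IH -exprS.
case: ifP => le; last by rewrite subst_fst0 subr0.
by rewrite subst_fstM subst_fstXn subst_fst_X0 expr0n subn_eq0 ltnNge le mul0r subr0.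
Qed.

(** Modulo [x], [ci_f] becomes a power of ['X], which is not 0; hence if [x] divides [u * ci_f] it
    divides [u]. *)
Lemma ci_f_dvd_cancelX n h : ideal1 ci_f (x ^+ n * h) -> ideal1 ci_f h.
Proof.
elim: n => [|n IH]; first by rewrite mul1r.
rewrite exprS -mulrA => -[u e]; apply: IH.
have : subst_fst 0 (u * ci_f) = 0 by rewrite -e subst_fstM subst_fst_X0 mul0r.
move/eqP; rewrite subst_fstM subst0_row_poly mulf_eq0 => /orP[/eqP u0|]; last first.
  by rewrite expf_eq0 polyX_eq0 andbF.
have [u' eu] := subst_fst0_dvd u0; exists u'.
have nzx : x != 0 by apply/eqP => /(congr1 (@subst_fst K 1)) /eqP;
  rewrite subst_fst_X0 subst_fst0 oner_eq0.
by apply: (mulfI nzx); rewrite e eu mulrA.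
Qed.

(** [1] is the first vector of the string of row 0, and the string vectors are independent modulo
    the ideal. *)
Lemma ci_not1 : ~ ci_ideal 1.
Proof.
move=> I1; have := ci_free (c := fun p => (p == (0, 0)%N)%:R) _ (j := (0, 0)%N).
rewrite mem_ci_idx s0 len_gt0 // eqxx => H; have /eqP := oner_neq0 K; apply.
apply: H => //; apply: (ideal_sum_seq idI) => p _; case: eqP => [->|_].
  by rewrite scale1r ci_string_vec // mul1r.
by rewrite scale0r; apply: (ideal0 idI).
Qed.

(* As [x ^+ len 0] lies in [(f, g)], if [f] divides [g * h] then it divides
   [x ^+ len 0 * h], and [f] is monic in [y]. *)
Lemma ci_regular : regular_sequence ci_f ci_g.
Proof.
split; last exact: ci_not1.
  by move=> h /eqP; rewrite mulf_eq0 (negbTE ci_f_neq0) => /eqP.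
move=> h [u e]; apply: (@ci_f_dvd_cancelX (len 0)).
have [a [b eab]] := row_killed (leq0n s) (leqnn (len 0)).
exists (a * h + b * u); rewrite mulr1 in eab.
by rewrite eab !mulrDl -[b * u * _]mulrA -e !mulrA [a * ci_f * h]mulrAC.
Qed.

Lemma ci_graded : graded_ci ci_ideal.
Proof.
exists ci_f, ci_g, s, (N - s)%N; split=> //; [exact: homog_ci_f | exact: homog_ci_g|].
exact: ci_regular.
Qed.

Definition first_axis (i : 'I_2) : K := (i == 0)%:R.

Lemma lform_first_axis : lform first_axis = x.
Proof.
rewrite /lform big_ord_recl big_ord1 /first_axis /= scale1r scale0r addr0.
by congr 'X_ _; apply: val_inj.
Qed.

Lemma nonzero_first_axis : nonzero_vec first_axis.
Proof. by exists 0; rewrite /first_axis eqxx oner_neq0. Qed.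

Lemma ci_jordan_type : jordan_type ci_ideal (lform first_axis) P.
Proof.
split=> //; rewrite lform_first_axis; exists ci_strings; first exact: ci_string_decomposition.
by rewrite -map_comp -[X in perm_eq X](mkseq_nth 0%N P).
Qed.

(** * The socle of the constructed quotient *)

Definition degree_idx (n : nat) : seq (nat * nat) :=
  [seq p <- string_idx ci_strings | (p.1 + p.2 == n)%N].

Lemma mem_degree_idx n i t :
  (i, t) \in degree_idx n = [&& (i + t == n)%N, (i < s)%N & (t < len i)%N].
Proof. by rewrite mem_filter mem_ci_idx. Qed.

Lemma degree_idx_uniq n : uniq (degree_idx n).
Proof. by rewrite filter_uniq ?string_idx_uniq. Qed.

Lemma degree_idx_sub n : {subset degree_idx n <= string_idx ci_strings}.
Proof. by move=> p; rewrite mem_filter => /andP[]. Qed.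

Lemma homog_ci_span n h : h \is n.-homog -> exists c : nat * nat -> K,
  ci_ideal (h - \sum_(p <- degree_idx n) c p *: string_vec x ci_strings p).
Proof.
move=> hn; have [c /(homog_eqmod hoI (D := fun p => (p.1 + p.2)%N)) H] := ci_span h.
by exists c; apply: H => //; apply: homog_ci_string_vec.
Qed.

Lemma ci_ideal_large n h : (N.-1 <= n)%N -> h \is n.-homog -> ci_ideal h.
Proof.
move=> le /homog_ci_span[c]; rewrite big1_seq ?subr0 // => -[i t] /andP[_].
rewrite mem_degree_idx => /and3P[/eqP e lt lt'].
by have := ends_range lt; lia.
Qed.

(** The row of largest end, [N - 1]. Its last vector is the only string vector of degree [N - 2]. *)
Definition socle_row : nat := index N.-1 (ends P).
Definition socle_vec : R := x ^+ (len socle_row).-1 * row_poly socle_row.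

Lemma socle_rowP : (socle_row < s)%N /\ (socle_row + len socle_row = N.-1)%N.
Proof. by apply: row_of_end; lia. Qed.

Lemma single_free i t a : (i < s)%N -> (t < len i)%N ->
  ci_ideal (a *: (x ^+ t * row_poly i)) -> a = 0.
Proof.
move=> lt ltt; rewrite -ci_string_vec // => Ia.
apply: (string_shift_free idI (fl := [:: (i, t)]) (c := fun=> a) (a := 0%N)
          ci_string_decomposition _ _ _ (i := i) (t := t)); rewrite ?inE //.
- by move=> q; rewrite inE => /eqP ->; rewrite mem_ci_idx lt.
- by rewrite big_seq1 mul1r.
by rewrite nth_ci_strings.
Qed.

Lemma homog_socle_degree h : h \is (N - 2).-homog -> exists a, ci_ideal (h - a *: socle_vec).
Proof.
move=> /homog_ci_span[c Ic]; exists (\sum_(p <- degree_idx (N - 2)) c p).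
move: Ic; congr (ci_ideal (_ - _)); rewrite scaler_suml; apply: eq_big_seq => -[i t].
rewrite mem_degree_idx => /and3P[/eqP e lt lt']; congr (_ *: _).
have [lts es] := socle_rowP; have := ends_range lt => rg.
have ei : i = socle_row by apply: ends_inj => //; lia.
by rewrite ci_string_vec // /socle_vec -ei; congr (_ ^+ _ * _); lia.
Qed.

(** If [x * h] is in the ideal, [h] is a combination of last vectors of strings; ends being
    distinct, only one string, say of row [i], stops in degree [n]. Multiplying its last vector by
    [y] gives, modulo the ideal, up to sign conventions of the recursion the last vector of the row
    whose end is one more, which is independent; so the coefficient is 0. *)
Lemma ci_socle n h : h \is n.-homog -> (n < N - 2)%N ->
  ci_ideal (x * h) -> ci_ideal (y * h) -> ci_ideal h.
Proof.
move=> hn ltn Ix Iy; have [c Ic] := homog_ci_span hn.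
set S := \sum_(p <- _) _ in Ic.
have cz i t : (i, t) \in degree_idx n -> (t.+1 < len i)%N -> c (i, t) = 0.
  move=> it lt; have := it; rewrite mem_degree_idx => /and3P[_ lti _].
  apply: (string_shift_free idI (a := 1) ci_string_decomposition
    (degree_idx_uniq n) (@degree_idx_sub n) _ it); last by rewrite nth_ci_strings.
  rewrite expr1 -/S -[x * S](subKr (x * h)) -mulrBr.
  by apply: (idealB idI) => //; apply: (idealM idI).
have [/allP all0|/allPn[[i t] it nz]] := boolP (all (fun p => c p == 0) (degree_idx n)).
  move: Ic; rewrite /S big1_seq ?subr0 // => p /andP[_ /all0/eqP ->].
  by rewrite scale0r.
have := it; rewrite mem_degree_idx => /and3P[/eqP en lti ltt].
have lt1 : (t.+1 = len i)%N.
  by apply/eqP; rewrite eqn_leq ltt leqNgt; apply: contra nz => /(cz _ _ it) ->.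
have eS : S = c (i, t) *: (x ^+ t * row_poly i).
  rewrite /S (bigD1_seq (i, t)) ?degree_idx_uniq //= ci_string_vec //.
  rewrite big1_seq ?addr0 // => -[i' t'] /andP[ne it'].
  have := it'; rewrite mem_degree_idx => /and3P[/eqP en' lti' ltt'].
  rewrite (cz _ _ it') ?scale0r // ltn_neqAle ltt' andbT.
  apply: contra ne => /eqP e'; have ei : i' = i by apply: ends_inj => //; lia.
  by apply/eqP; congr pair => //; lia.
have {}Iy : ci_ideal (c (i, t) *: (x ^+ t * (y * row_poly i))).
  have -> : c (i, t) *: (x ^+ t * (y * row_poly i)) = y * h - y * (h - S).
    by rewrite -mulrBr subKr eS -scalerAr mulrCA.
  by apply: (idealB idI) => //; apply: (idealM idI).
have lN : ((i + len i).+1 < N)%N by lia.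
have [lw ew] := next_rowP lti lN; set w := next_row i in lw ew *.
rewrite row_poly_rec -/w in Iy.
case=> [[le ltl]|[ew' el]].
  rewrite le mulrDr scalerDr mulrA -exprD in Iy.
  have I1 : ci_ideal (c (i, t) *: (x ^+ t * row_poly i.+1)).
    by apply: (idealZ idI); apply: row_killed => //; lia.
  have := idealB idI Iy I1; rewrite addrC addKr => /single_free.
  by move=> c0; move: nz; rewrite c0 ?eqxx //; lia.
rewrite ew' ltnn addr0 in Iy.
have lsi : (i.+1 < s)%N by rewrite -ew'.
by move/single_free: Iy nz => -> //; rewrite ?eqxx //; lia.
Qed.

End Construction.

(** * The differentiation action and Hessians *)

Section DiffAct.
Variable K : fieldType.
Local Notation R := {mpoly K[2]}.
Implicit Types f g h F G H : R.

(** Summing over all monomials of bounded degree instead of the support gives different polynomials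
    a common index set, as linearity requires. *)
Lemma diff_actwE k f F : (msize f <= k)%N ->
  diff_act f F = \sum_(m : 'X_{1..2 < k}) f@_m *: F^`M[m].
Proof.
pose I : subFinType _ := 'X_{1..2 < k}.
move=> le_pk; rewrite /diff_act (big_mksub I) /=; first last.
- by move=> m /msize_mdeg_lt /leq_trans /(_ le_pk).
- by rewrite msupp_uniq.
by rewrite big_rmcond //= => m /memN_msupp_eq0 ->; rewrite scale0r.
Qed.

Lemma diff_act_linearl a f g F :
  diff_act (a *: f + g) F = a *: diff_act f F + diff_act g F.
Proof.
pose k := maxn (msize (a *: f + g)) (maxn (msize f) (msize g)).
rewrite !(diff_actwE (k := k)) /k ?leq_max ?leqnn ?orbT //.
rewrite scaler_sumr -big_split /=; apply: eq_bigr => m _.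
by rewrite mcoeffD mcoeffZ scalerDl scalerA.
Qed.

Lemma diff_act0l F : diff_act 0 F = 0.
Proof. by rewrite /diff_act msupp0 big_nil. Qed.

Lemma diff_actDl f g F : diff_act (f + g) F = diff_act f F + diff_act g F.
Proof. by rewrite -[f in LHS]scale1r diff_act_linearl scale1r. Qed.

Lemma diff_actZl a f F : diff_act (a *: f) F = a *: diff_act f F.
Proof. by rewrite -[a *: f]addr0 diff_act_linearl diff_act0l addr0. Qed.

Lemma diff_act_suml (J : Type) (s : seq J) (Q : pred J) (f : J -> R) F :
  diff_act (\sum_(j <- s | Q j) f j) F = \sum_(j <- s | Q j) diff_act (f j) F.
Proof.
by elim/big_rec2: _ => [|j a b _ <-]; rewrite ?diff_act0l // diff_actDl.
Qed.

Lemma diff_act_sumr (J : Type) (s : seq J) (Q : pred J) f (F : J -> R) :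
  diff_act f (\sum_(j <- s | Q j) F j) = \sum_(j <- s | Q j) diff_act f (F j).
Proof.
rewrite /diff_act exchange_big /=; apply: eq_bigr => m _.
by rewrite linear_sum scaler_sumr.
Qed.

Lemma diff_actZr a f F : diff_act f (a *: F) = a *: diff_act f F.
Proof.
rewrite /diff_act scaler_sumr; apply: eq_bigr => m _.
by rewrite linearZ /= !scalerA mulrC.
Qed.

Lemma diff_act0r f : diff_act f 0 = 0.
Proof. by rewrite /diff_act big1 // => m _; rewrite linear0 scaler0. Qed.

Lemma diff_actX m F : diff_act 'X_[m] F = F^`M[m].
Proof. by rewrite /diff_act msuppX big_seq1 mcoeffX eqxx scale1r. Qed.

Lemma diff_actM f g F : diff_act (f * g) F = diff_act f (diff_act g F).
Proof.
rewrite {1}[f]mpolyE {1}[g]mpolyE mulr_suml diff_act_suml [RHS]/diff_act.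
apply: eq_bigr => m _; rewrite mulr_sumr diff_act_suml linear_sum scaler_sumr.
apply: eq_bigr => m' _ /=.
rewrite -scalerAl -scalerAr !diff_actZl -mpolyXD diff_actX.
by rewrite addmC mderivmDm mderivmZ !scalerA.
Qed.

Lemma mcoeff_diff_act f F m : (diff_act f F)@_m =
  \sum_(m' <- msupp f) f@_m' * (F@_(m' + m) *+ \prod_(i < 2) ((m' + m)%MM i) ^_ (m' i)).
Proof.
rewrite /diff_act raddf_sum /=; apply: eq_bigr => m' _.
by rewrite mcoeffZ mcoeff_mderivm.
Qed.

Lemma homog_diff_act n b f F : f \is n.-homog -> F \is b.-homog ->
  diff_act f F \is (b - n).-homog.
Proof.
move=> hf hF; rewrite /diff_act big_seq; apply: rpred_sum => m /(dhomog_mf hf) /= em.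
apply: rpredZ; apply/dhomogP => m'; rewrite mcoeff_msupp mcoeff_mderivm => nz.
have : F@_(m + m') != 0 by apply: contraNneq nz => ->; rewrite mul0rn.
by rewrite -mcoeff_msupp => /(dhomog_mf hF) /=; rewrite mdegD em => <-; rewrite addKn.
Qed.

Lemma diff_act_large n b f F : f \is n.-homog -> F \is b.-homog -> (b < n)%N ->
  diff_act f F = 0.
Proof.
move=> hf hF lt; apply/mpolyP => m; rewrite mcoeff0 mcoeff_diff_act big_seq.
apply: big1 => m' /(dhomog_mf hf) /= em.
rewrite (dhomog_nemf_coeff hF) ?mul0rn ?mulr0 //=.
by rewrite mdegD em; apply/eqP; lia.
Qed.

Lemma homog0_const f : f \is 0.-homog -> f = (f@_0)%:MP.
Proof.
move=> hf; apply/mpolyP => m; rewrite mcoeffC.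
have [->|ne] := eqVneq m 0%MM; first by rewrite mulr1.
by rewrite mulr0 (dhomog_nemf_coeff hf) // mdeg_eq0.
Qed.

Lemma euler_identity e (v : 'I_2 -> K) G : G \is e.-homog ->
  (diff_act (lform v) G).@[v] = e%:R * G.@[v].
Proof.
move=> hG; rewrite [G]mpolyE diff_act_sumr !raddf_sum /= mulr_sumr big_seq [RHS]big_seq.
apply: eq_bigr => m /(dhomog_mf hG) /= em.
rewrite diff_actZr !mevalZ mulrCA; congr (_ * _).
rewrite /lform diff_act_suml raddf_sum /= -em mdegE natr_sum mulr_suml.
apply: eq_bigr => i _; rewrite diff_actZl mevalZ diff_actX mderivmU1m mderivX mevalZ.
rewrite mulrCA; have [->|nz] := eqVneq (m i) 0%N; first by rewrite !mul0r.
have em' : m = (U_(i) + (m - U_(i)))%MM by rewrite addmC submK // lep1mP.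
by congr (_ * _); rewrite {2}em' mpolyXD mevalM mevalXU.
Qed.

(** Euler's identity iterated. It turns values at [v] into the action of powers of [lform v], and so
    links Hessians to strings. *)
Lemma diff_act_lform_exp e (v : 'I_2 -> K) G : G \is e.-homog ->
  diff_act (lform v ^+ e) G = (e`!%:R * G.@[v])%:MP.
Proof.
elim: e G => [|e IH] G hG.
  rewrite expr0 fact0 mul1r -[X in diff_act X](mpolyX0 2 K) diff_actX mderivm0m.
  by rewrite {1 2}(homog0_const hG) mevalC.
have hd := homog_diff_act (homog_lform v) hG; rewrite subSS subn0 in hd.
rewrite exprSr diff_actM IH // (euler_identity _ hG) factS; congr _%:MP.
by rewrite natrM mulrCA mulrA.
Qed.

Lemma pihomog_diff_act n j h F : F \is j.-homog -> (n <= j)%N ->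
  pihomog mdeg (j - n) (diff_act h F) = diff_act (pihomog mdeg n h) F.
Proof.
move=> hF le; pose k := maxn n.+1 (mmeasure mdeg h).
have hk : (mmeasure mdeg h <= k)%N by rewrite leq_maxr.
rewrite {1}(pihomog_partitionE hk) diff_act_suml linear_sum /=.
have lt : (n < k)%N by rewrite leq_max ltnSn.
rewrite (bigD1 (Ordinal lt)) //= big1 ?addr0.
  by rewrite pihomog_dE //; apply: homog_diff_act hF; apply: pihomogP.
move=> i ne; have hi := pihomogP mdeg i h.
have [ij|ji] := leqP i j; last by rewrite (diff_act_large hi hF ji) linear0.
apply: pihomog_ne0 (homog_diff_act hi hF).
have : nat_of_ord i != n by apply: contra ne => /eqP e; apply/eqP/val_inj.
lia.
Qed.

Hypothesis pchar0 : [pchar K] =i pred0.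

Lemma natr_neq0 n : (0 < n)%N -> (n%:R : K) != 0.
Proof. by move/pcharf0P: pchar0 => ->; rewrite lt0n. Qed.

Lemma fact_neq0 n : (n`!%:R : K) != 0.
Proof. by apply: natr_neq0; apply: fact_gt0. Qed.

Lemma diff_act_nondegenerate i H : H \is i.-homog ->
  (forall r, r \is i.-homog -> diff_act r H = 0) -> H = 0.
Proof.
move=> hH H0; apply/mpolyP => m; rewrite mcoeff0.
have [em|ne] := eqVneq (mdeg m) i; last exact: dhomog_nemf_coeff hH ne.
have := H0 'X_[m]; rewrite dhomogX /= em eqxx => /(_ isT) /(congr1 (mcoeff 0%MM)).
rewrite diff_actX mcoeff_mderivm mcoeff0 addm0 -mulr_natr natr_prod => /eqP.
rewrite mulf_eq0 prodf_seq_eq0 => /orP[/eqP //|/hasP[k _]].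
by rewrite ffactnn (negbTE (fact_neq0 _)).
Qed.

Lemma Ann_ideal F : ideal_pred (Ann F).
Proof.
rewrite /Ann; split=> [|a b ha hb|r a ha]; first exact: diff_act0l.
- by rewrite diff_actDl ha hb addr0.
- by rewrite diff_actM ha diff_act0r.
Qed.

(** Up to the factor [(j - 2 * i)!], the matrix evaluated at [v] is the Gram matrix of the bilinear
    form [a, b |-> l^(j - 2i) a b] applied to [F], on forms of degree [i] modulo [Ann F]. Since a
    form of degree [i] annihilated by all forms of degree [i] is 0, the radical of this bilinear
    form is the kernel of [l^(j - 2i)]. *)
Lemma hessian_zeroP F j i (v : 'I_2 -> K) n (alpha : n.-tuple R) :
    F \is j.-homog -> (2 * i <= j)%N -> basis_of_degree (Ann F) i alpha ->
  (hessian F alpha).@[v] = 0 <->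
  exists b, [/\ b \is i.-homog, ~ Ann F b & Ann F (lform v ^+ (j - 2 * i) * b)].
Proof.
move=> hF le [homa free span]; have idA := Ann_ideal F.
have halpha (u : 'I_n) : alpha`_u \is i.-homog by rewrite -tnth_nth.
have free' (c : 'I_n -> K) : Ann F (\sum_(u < n) c u *: alpha`_u) -> forall u, c u = 0.
  move: free; rewrite /free_mod; have := size_tuple alpha.
  move: (size alpha) => n' en; subst n'; exact.
have span' r : r \is i.-homog ->
      exists c : 'I_n -> K, Ann F (r - \sum_(u < n) c u *: alpha`_u).
  move=> /span; rewrite /span_mod; have := size_tuple alpha.
  by move: (size alpha) => n' en; subst n'.
pose M : 'M[K]_n := \matrix_(u, w) (diff_act (alpha`_u * alpha`_w) F).@[v].
have -> : (hessian F alpha).@[v] = \det M.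
  rewrite /hessian -det_map_mx; congr (\det _); apply/matrixP => u w.
  by rewrite !mxE !(tnth_nth 0).
have pair b : b \is i.-homog -> forall w : 'I_n,
    diff_act alpha`_w (diff_act (lform v ^+ (j - 2 * i) * b) F) =
    ((j - 2 * i)`!%:R * (diff_act (b * alpha`_w) F).@[v])%:MP.
  move=> hb w; rewrite -diff_actM mulrC -mulrA (diff_actM (lform v ^+ _)).
  rewrite diff_act_lform_exp //.
  have := homog_diff_act (dhomogM hb (halpha w)) hF.
  by rewrite addnn -mul2n.
have comb (c : 'rV[K]_n) w : (c *m M) 0 w =
    (diff_act ((\sum_(u < n) c 0 u *: alpha`_u) * alpha`_w) F).@[v].
  rewrite mxE mulr_suml diff_act_suml raddf_sum /=; apply: eq_bigr => u _.
  by rewrite mxE -scalerAl diff_actZl mevalZ.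
split=> [/eqP/det0P[c nzc cM]|[b [hb nAb Ab]]].
  pose b := \sum_(u < n) c 0 u *: alpha`_u.
  have hb : b \is i.-homog by apply: rpred_sum => u _; apply: rpredZ.
  exists b; split=> //.
    move/free' => c0; move/eqP: nzc; apply; apply/rowP => u.
    by rewrite c0 mxE.
  pose H := diff_act (lform v ^+ (j - 2 * i) * b) F.
  have hH : H \is i.-homog.
    have := homog_diff_act (dhomogM (homog_exp (j - 2 * i) (homog_lform v)) hb) hF.
    by congr (_ \is _.-homog); lia.
  apply: (diff_act_nondegenerate hH) => r /span'[e Ae].
  have : diff_act (r - \sum_(u < n) e u *: alpha`_u) H = 0.
    by rewrite /H -diff_actM mulrC diff_actM Ae diff_act0r.
  rewrite diff_actDl -scaleN1r diff_actZl scaleN1r diff_act_suml big1 ?subr0 // => w _.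
  by rewrite diff_actZl pair // -comb cM mxE mulr0 mpolyC0 scaler0.
have [c Ac] := span' b hb.
apply/eqP/det0P; exists (\row_u c u).
  apply/eqP => c0; apply: nAb; apply: (idealBl idA Ac).
  apply: (ideal_sum idA) => u _; move/rowP/(_ u): c0; rewrite !mxE => ->.
  by rewrite scale0r; apply: (ideal0 idA).
apply/rowP => w; rewrite comb [RHS]mxE.
have -> : diff_act ((\sum_(u < n) (\row_u c u) 0 u *: alpha`_u) * alpha`_w) F =
    diff_act (b * alpha`_w) F.
  under eq_bigr do rewrite mxE.
  set b' := \sum_(u < n) _ in Ac *.
  rewrite -[b in RHS](subrK b') mulrDl diff_actDl [(b - b') * _]mulrC.
  by rewrite [diff_act (_ * (b - b')) F]diff_actM Ac diff_act0r add0r.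
have := pair b hb w; rewrite Ab diff_act0r => /esym/eqP.
by rewrite mpolyC_eq0 mulf_eq0 (negbTE (fact_neq0 _)) => /eqP.
Qed.

End DiffAct.

(** * Vanishing Hessians and Macaulay duals *)

Section StringKernel.
Variables (K : fieldType) (I : {mpoly K[2]} -> Prop) (l : {mpoly K[2]}).
Hypothesis idealI : ideal_pred I.
Hypothesis homogI : forall n h, I h -> I (pihomog mdeg n h).
Hypothesis homog_l : l \is 1.-homog.
Local Notation R := {mpoly K[2]}.
Variables (P : seq nat) (e : nat -> R).
Hypothesis homog_e : forall i, e i \is i.-homog.
Local Notation gs := [seq (e i, nth 0%N P i) | i <- iota 0 (size P)].
Hypothesis sd : string_decomposition I l gs.

Let gsE i : (i < size P)%N -> nth (0%R, 0%N) gs i = (e i, nth 0%N P i).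
Proof. by move=> lt; rewrite (nth_map 0%N) ?size_iota // nth_iota. Qed.

Let idxE i t : ((i, t) \in string_idx gs) = (i < size P)%N && (t < nth 0%N P i)%N.
Proof. by rewrite mem_string_idx size_map size_iota; case: ltnP => // lt; rewrite gsE. Qed.

Let fl n := [seq p <- string_idx gs | (p.1 + p.2 == n)%N].

Let flE n i t : ((i, t) \in fl n) = [&& (i + t == n)%N, (i < size P)%N & (t < nth 0%N P i)%N].
Proof. by rewrite mem_filter idxE. Qed.

Let flU n : uniq (fl n). Proof. by rewrite filter_uniq ?string_idx_uniq. Qed.

Let homog_vec p : p \in string_idx gs -> string_vec l gs p \is (p.1 + p.2).-homog.
Proof.
case: p => i t; rewrite idxE => /andP[lt _].
by apply: (homog_string_vec homog_l (D := id)); rewrite gsE //; apply: homog_e.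
Qed.

Let span_fl n r : r \is n.-homog -> spanI I (fl n) (string_vec l gs) r.
Proof.
move=> hr; have [_ _ sp] := (string_decompositionE I l gs).1 sd.
have [c hc] := sp r; exists c.
exact: (homog_eqmod homogI (D := fun p => (p.1 + p.2)%N)) homog_vec hr hc.
Qed.

Lemma homog_basis_exists n : exists m (alpha : m.-tuple R), basis_of_degree I n alpha.
Proof.
exists (size [seq string_vec l gs p | p <- fl n]).
exists (in_tuple [seq string_vec l gs p | p <- fl n]).
split.
- move=> u; have /mapP[p pin ->] := mem_tnth u (in_tuple [seq string_vec l gs p | p <- fl n]).
  move: pin; rewrite mem_filter => /andP[/eqP <- h]; exact: homog_vec.
- have [_ fr _] := (string_decompositionE I l gs).1 sd.
  by apply/free_mod_map => //; apply: freeI_filter.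
- by move=> r /span_fl; apply: (span_mod_map _ _ _ _).2.
Qed.

(** By [string_shift_free] the kernel of [l ^+ a] in degree [i] is spanned by the string vectors of
    degree [i] that [l ^+ a] pushes off their string. The string of row [u] has a vector in degree
    [i] when [u <= i < u + p_u]. *)
Lemma string_kernelP i a :
  (exists b, [/\ b \is i.-homog, ~ I b & I (l ^+ a * b)]) <->
  exists u, [/\ (u < size P)%N, (u <= i < u + nth 0 P u)%N & (u + nth 0 P u <= i + a)%N].
Proof.
split=> [[b [hb nIb Iab]]|[u [lu /andP[ui iu] ua]]]; last first.
  exists (l ^+ (i - u) * e u); split.
  - rewrite -[X in X.-homog](subnK ui).
    exact: dhomogM (homog_exp _ homog_l) (homog_e u).
  - move=> Iu; have := string_shift_free idealI (fl := [:: (u, i - u)%N])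
      (c := fun=> 1) (a := 0%N) sd.
    move=> /(_ isT) H; have /eqP := oner_neq0 K; apply; apply: (H _ _ u (i - u)%N).
    + by move=> p; rewrite inE => /eqP ->; rewrite idxE lu; lia.
    + by rewrite big_seq1 mul1r scale1r /string_vec gsE.
    + by rewrite inE.
    by rewrite gsE //=; lia.
  rewrite mulrA -exprD.
  have := string_killed (t := (a + (i - u))%N) idealI sd (i := u).
  by rewrite size_map size_iota /string_vec gsE //=; apply => //; lia.
apply: NNPP => none; apply: nIb.
have [c Ic] := span_fl hb; move: (Ic); rewrite big1_seq ?subr0 // => -[u t] /andP[_ ut].
have := ut; rewrite flE => /and3P[/eqP en lu lt].
rewrite (string_shift_free idealI (a := a) sd (flU i) _ _ ut) ?scale0r //.
- by move=> p; rewrite mem_filter => /andP[].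
- set S := \sum_(p <- _) _; rewrite -[S](subKr b) mulrBr.
  by apply: idealB => //; apply: idealM.
rewrite gsE //= ltnNge; apply/negP => le; apply: none.
by exists u; split=> //; lia.
Qed.

End StringKernel.

Lemma hessian_vanishesP (K : fieldType) (d k : nat) (P : seq nat) (F : {mpoly K[2]})
    (v : 'I_2 -> K) (i : nat) : [pchar K] =i pred0 -> (1 <= k)%N -> (i < d)%N ->
    dual_realizes d k P F v ->
  hessian_vanishes F i v <->
  exists u, [/\ (u < size P)%N, (u <= i < u + nth 0 P u)%N &
    (u + nth 0 P u + i <= socle_degree d k)%N].
Proof.
move=> pc0 hk hi [hF ciF nzv jt].
have idA := graded_ci_ideal ciF; have hoA := graded_ci_homog ciF.
have [e he sd] := jordan_graded_strings ciF nzv jt.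
have le : (2 * i <= socle_degree d k)%N by rewrite /socle_degree; lia.
have ker := string_kernelP idA hoA (homog_lform v) he sd i (socle_degree d k - 2 * i).
split=> [[n [alpha [ba /(hessian_zeroP pc0 v hF le ba) /ker[u [h1 h2 h3]]]]]|[u [h1 h2 h3]]].
  by exists u; split=> //; lia.
have [n [alpha ba]] := homog_basis_exists hoA (homog_lform v) he sd i.
exists n, alpha; split=> //; apply/(hessian_zeroP pc0 v hF le ba)/ker.
by exists u; split=> //; lia.
Qed.

(** * A Macaulay dual generator of the constructed ideal *)

Section Dual.
Variables (K : fieldType) (P : seq nat) (N : nat).
Local Notation R := {mpoly K[2]}.
Hypotheses (isP : is_partition P) (s0 : (0 < size P)%N).
Hypotheses (hN : (size P <= N)%N) (N2 : (2 <= N)%N).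
Hypothesis pe : perm_eq (ends P) (iota (N - size P) (size P)).
Hypothesis pchar0 : [pchar K] =i pred0.
Local Notation I := (@ci_ideal K P N).
Local Notation j := (N - 2)%N.

Let idI : ideal_pred I := ideal2_ideal _ _.

(** Descending induction from the socle degree: [ci_socle] passes from the multiples of [h] by the
    variables to [h]. *)
Lemma ci_nonsocle n h : h \is n.-homog -> (n <= j)%N ->
  (forall m, (mdeg m + n = j)%N -> I ('X_[m] * h)) -> I h.
Proof.
move: {2}(j - n)%N (erefl (j - n)%N) => r; elim: r n h => [|r IH] n h en hn le H.
  have := H 0%MM; rewrite mpolyX0 mul1r mdeg0; apply; lia.
have ci i : I ('X_i * h).
  apply: (IH n.+1); [lia|exact: dhomogM (homog_var K i) hn|lia|].
  move=> m em; rewrite mulrA -mpolyXD; apply: H.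
  by rewrite mdegD mdeg1; lia.
by apply: (ci_socle isP s0 hN pe hn); first lia; apply: ci.
Qed.

(* [F] encodes the functional on the forms of degree [j] with kernel [I]. *)
Lemma ci_dual : exists F : R, F \is j.-homog /\ forall h, Ann F h <-> I h.
Proof.
have /(fun h m => constructive_indefinite_description _ (h m)) Phi : forall m : 'X_{1..2},
    exists a, mdeg m = j -> I ('X_[m] - a *: socle_vec K P N).
  move=> m; have [em|ne] := eqVneq (mdeg m) j; last by exists 0 => em; rewrite em eqxx in ne.
  have [|a Ia] := homog_socle_degree isP s0 hN pe (h := 'X_[m] : R).
    by rewrite dhomogX /= em.
  by exists a.
pose phi m := sval (Phi m).
have phiP m : mdeg m = j -> I ('X_[m] - phi m *: socle_vec K P N).
  by rewrite /phi; case: (Phi m).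
pose mfact (m : 'X_{1..2}) : nat := (\prod_(i < 2) (m i)`!)%N.
have nzf m : ((mfact m)%:R : K) != 0.
  apply: natr_neq0 => //; rewrite /mfact big_ord_recl big_ord1 muln_gt0.
  by rewrite !fact_gt0.
(* The division by the product of the factorials of the exponents compensates for differentiation: a
   monomial of degree [j] applied to [F] then gives its [phi], and the coefficients of [h] applied
   to [F] are, up to such factorials, the values of the functional on monomial multiples of [h]. *)
pose F : R := \sum_(m : 'X_{1..2 < j.+1} | mdeg m == j) (phi m / (mfact m)%:R) *: 'X_[m].
have hF : F \is j.-homog.
  by apply: rpred_sum => m em; apply: rpredZ; rewrite dhomogX.
have Fm m : mdeg m = j -> F@_m = phi m / (mfact m)%:R.
  move=> em; have lt : (mdeg m < j.+1)%N by rewrite em.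
  rewrite /F raddf_sum (bigD1 (BMultinom lt)) /=; last by rewrite em.
  rewrite mcoeffZ mcoeffX eqxx mulr1 big1 ?addr0 // => m' /andP[_ ne].
  rewrite mcoeffZ mcoeffX; case: eqP => [e|_]; last by rewrite mulr0.
  by case/eqP: ne; apply: val_inj.
have pairing n h m : h \is n.-homog -> (mdeg m + n = j)%N ->
    (diff_act h F)@_m = 0 <-> I ('X_[m] * h).
  move=> hn en; pose a := \sum_(m' <- msupp h) h@_m' * phi (m' + m)%MM.
  have -> : (diff_act h F)@_m = a / (mfact m)%:R.
    rewrite mcoeff_diff_act /a mulr_suml !big_seq; apply: eq_bigr => m' /(dhomog_mf hn) /= em'.
    rewrite Fm; last by rewrite mdegD em' addnC.
    rewrite -mulrA; congr (_ * _).
    rewrite -[LHS]mulr_natr -mulrA; congr (_ * _).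
    apply: (mulfI (nzf (m' + m)%MM)); rewrite mulrA mulfV // mul1r.
    apply: (mulIf (nzf m)); rewrite -[RHS]mulrA mulVf // mulr1 -natrM; congr _%:R.
    rewrite /mfact -big_split /=; apply: eq_bigr => i _.
    by rewrite mnmDE -{2}[m i](addKn (m' i)) ffact_fact // leq_addr.
  have Ia : I ('X_[m] * h - a *: socle_vec K P N).
    rewrite {1}[h]mpolyE /a mulr_sumr scaler_suml -sumrB big_seq.
    apply: (ideal_sum idI) => m' /(dhomog_mf hn) /= em'.
    rewrite -scalerAr -mpolyXD addmC -scalerA -scalerBr; apply: (idealZ idI).
    by apply: phiP; rewrite mdegD em' addnC.
  split=> [/eqP|Ih].
    rewrite mulf_eq0 invr_eq0 (negbTE (nzf m)) orbF => /eqP a0.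
    by move: Ia; rewrite a0 scale0r subr0.
  have Iv : I (a *: socle_vec K P N).
    by rewrite -[a *: _](subKr ('X_[m] * h)); apply: (idealB idI).
  have [lt _] := socle_rowP s0 hN pe.
  rewrite (single_free isP s0 hN pe lt _ Iv) ?mul0r //.
  by have := len_gt0 isP lt; lia.
exists F; split=> // h; split=> [hA|Ih].
  rewrite (pihomog_partitionE (leqnn (mmeasure mdeg h))); apply: (ideal_sum idI) => n _.
  have hn := pihomogP mdeg n h; have [le|lt] := leqP n j; last first.
    by apply: (ci_ideal_large isP s0 hN pe _ hn); lia.
  apply: (ci_nonsocle hn le) => m em; apply/(pairing _ _ _ hn em).
  by rewrite -(pihomog_diff_act h hF le) hA linear0 mcoeff0.
rewrite /Ann (pihomog_partitionE (leqnn (mmeasure mdeg h))) diff_act_suml.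
apply: big1 => n _; have hn := pihomogP mdeg n h.
have [le|lt] := leqP n j; last exact: diff_act_large hn hF lt.
apply/mpolyP => m; rewrite mcoeff0.
have [em|ne] := eqVneq (mdeg m) (j - n)%N; last first.
  exact: dhomog_nemf_coeff (homog_diff_act hn hF) ne.
apply/(pairing _ _ _ hn); first by rewrite em; lia.
apply: (idealM idI); apply: ideal2_homog Ih; [exact: homog_ci_f|exact: homog_ci_g].
Qed.

End Dual.

(** * Classification of the CIJT partitions *)

Lemma has_card_ext (T : eqType) (S S' : T -> Prop) n :
  (forall x, S x <-> S' x) -> has_card S n -> has_card S' n.
Proof.
by move=> h [L [U sz hL]]; exists L; split=> // x; split=> [/hL/h|/h/hL].
Qed.

Section TypeT.
Variables (K : fieldType) (d k : nat).
Hypotheses (hd : (1 <= d)%N) (hk : (1 <= k)%N).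
Local Notation N := (2 * d + k - 1)%N.

Lemma type_T_ends s P : s = d \/ s = (d + k - 1)%N -> has_type_T d k s P ->
  [/\ is_partition P, (0 < size P)%N, (size P <= N)%N &
      perm_eq (ends P) (iota (N - size P) (size P))].
Proof.
move=> hs [isP /diag_lengths_T pe sP]; split=> //; first by rewrite sP; lia.
  by rewrite sP; lia.
by apply: pe => //; rewrite sP.
Qed.

Lemma cijt_partsP s P : s = d \/ s = (d + k - 1)%N ->
  cijt_parts K d k s P <-> has_type_T d k s P.
Proof.
move=> hs; split=> [[[isP dl _] sP]|h]; first by split.
have [isP s0 hN pe] := type_T_ends hs h; have [_ dl sP] := h.
split=> //; split=> //; exists (@ci_ideal K P N), (first_axis K); split.
- exact: ci_graded.
- exact: nonzero_first_axis.
- exact: ci_jordan_type.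
Qed.

(** The condition [i < u + p_u] of [hessian_vanishesP] is left out: in both cases all ends are at
    least [d], hence exceed [i]. *)
Definition vanishing_set (P : seq nat) : {set 'I_d} :=
  [set i : 'I_d | [exists u : 'I_(size P),
     (u <= i)%N && (u + nth 0%N P u + i <= socle_degree d k)%N]].

Lemma vanishing_setP s P : [pchar K] =i pred0 -> (2 <= k)%N ->
  s = d \/ s = (d + k - 1)%N -> has_type_T d k s P ->
  vanishing_active_hessians K k P (vanishing_set P).
Proof.
move=> pc0 k2 hs h; have [isP s0 hN pe] := type_T_ends hs h; have [_ _ sP] := h.
split.
  have N2 : (2 <= N)%N by lia.
  have [F [hF hA]] := ci_dual isP s0 hN N2 pe pc0.
  have eA : Ann F = ci_ideal P N.
    by apply: functional_extensionality => r; apply: propositional_extensionality.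
  exists F, (first_axis K); split.
  - by move: hF; congr (_ \is _.-homog); rewrite /socle_degree; lia.
  - by rewrite eA; exact: ci_graded.
  - exact: nonzero_first_axis.
  - by rewrite eA; exact: ci_jordan_type.
move=> F v hF i; rewrite inE.
have H := hessian_vanishesP pc0 hk (ltn_ord i) hF.
split=> [/existsP[u /andP[h1 h2]]|/H[u [h1 /andP[h2 _] h3]]].
  apply/H; exists u; split=> //.
  have := ends_range hN pe (ltn_ord u); have := ltn_ord i.
  rewrite h1 /=; move: (nat_of_ord u) {h1 h2} => u'.
  by rewrite sP; case: hs => ->; lia.
by apply/existsP; exists (Ordinal h1); rewrite h2.
Qed.

(** The rows before the last block, which starts in row [d - b], are common to both partitions. The
    smallest end in that block is [d + k - 1] for [P] and [d] after the replacement. Against the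
    socle degree [2d + k - 3] the former accounts for [d - b <= i <= d - 2], the latter, as
    [k >= 2], for [d - b <= i <= d - 1]. *)
Lemma vanishing_set_iota P : (2 <= k)%N -> has_type_T d k d P ->
  vanishing_set (iota_part k P) =
    vanishing_set P :|: [set i : 'I_d | nat_of_ord i == (d - 1)%N].
Proof.
move=> k2 /(type_T_d hd hk)[bs cb eP].
have [bs' [b [ebs b0 p sb]]] := composition_last hd cb.
have [_ _ eI] := iota_part_block hd hk p b0 sb; rewrite -ebs -eP in eI.
have szP : size P = d by rewrite eP size_block_partition; case/andP: cb => _ /eqP.
have szI : size (iota_part k P) = (d + k - 1)%N.
  by rewrite eI size_block_partition sumn_rcons; lia.
have nthP u : (u < size P)%N ->
    nth 0%N P u = if (u < sumn bs')%N then nth 0%N (block_partition N bs') u else (b + k - 1)%N.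
  rewrite szP => lu; rewrite eP ebs block_partition_rcons nth_cat size_block_partition.
  by case: ltnP => // ge; rewrite nth_nseq ifT; lia.
have nthI u : (u < size (iota_part k P))%N -> nth 0%N (iota_part k P) u =
    if (u < sumn bs')%N then nth 0%N (block_partition N bs') u else b.
  rewrite szI => lu; rewrite eI block_partition_rcons nth_cat size_block_partition.
  by case: ltnP => // ge; rewrite nth_nseq ifT; lia.
have mP : (sumn bs' < size P)%N by lia.
have mI : (sumn bs' < size (iota_part k P))%N by lia.
apply/setP => i; rewrite !inE; have lti := ltn_ord i.
have [ei|ne] := eqVneq (nat_of_ord i) (d - 1)%N.
  rewrite orbT; apply/existsP; exists (Ordinal mI) => /=.
  by rewrite nthI // ltnn /socle_degree ei; lia.
rewrite orbF; apply/existsP/existsP => -[u /andP[ui ule]].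
  have [lt|ge] := ltnP u (sumn bs').
    have lu : (u < size P)%N by lia.
    exists (Ordinal lu) => /=; move: ule; rewrite nthP // nthI // lt => ->.
    by rewrite ui.
  exists (Ordinal mP) => /=; rewrite nthP // ltnn /socle_degree; lia.
have [lt|ge] := ltnP u (sumn bs').
  have lu : (u < size (iota_part k P))%N by lia.
  exists (Ordinal lu) => /=; move: ule; rewrite nthP // nthI // lt => ->.
  by rewrite ui.
exists (Ordinal mI) => /=; rewrite nthI // ltnn /socle_degree; lia.
Qed.

End TypeT.

Theorem theorem3p23 (K : fieldType) (d k : nat)
  (hKinf : infinite_field K)
  (hKchar : forall p : nat, p \in [pchar K]%R -> (socle_degree d k < p)%N)
  (hd : (1 <= d)%N) (hk : (1 <= k)%N) :
  (* (a) *)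
  ((forall P : seq nat, cijt_parts K d k d P ->
      (exists2 a : nat, (a <= d - 1)%N &
         smallest_part P = (a + k)%N /\ count_mem (a + k)%N P = (a + 1)%N)
      /\ cijt_parts K d k (d + k - 1) (iota_part k P))
   /\ (forall P Q : seq nat, cijt_parts K d k d P -> cijt_parts K d k d Q ->
         iota_part k P = iota_part k Q -> P = Q)
   /\ (forall Q : seq nat, cijt_parts K d k (d + k - 1) Q ->
         exists2 P : seq nat, cijt_parts K d k d P & iota_part k P = Q)
   /\ ((2 <= k)%N -> [pchar K]%R =i pred0 ->
       forall P : seq nat, cijt_parts K d k d P ->
         exists V : {set 'I_d},
           vanishing_active_hessians K k P V /\
           vanishing_active_hessians K k (iota_part k P)
             (V :|: [set i : 'I_d | nat_of_ord i == (d - 1)%N])))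
  (* (b) *)
  /\ (has_card (cijt_parts K d k d) (2 ^ (d - 1)) /\
      has_card (cijt_parts K d k (d + k - 1)) (2 ^ (d - 1)))
  (* (c) *)
  /\ ((2 <= d)%N ->
      (forall a : nat, (a <= d - 2)%N ->
         has_card (fun P : seq nat =>
             cijt_parts K d k d P /\ smallest_part P = (a + k)%N)
           (2 ^ (d - 2 - a)))
      /\ (exists P : seq nat,
            unique (fun Q : seq nat =>
              cijt_parts K d k d Q /\ smallest_part Q = (d + k - 1)%N) P
            /\ count_mem (d + k - 1)%N P = d))
  (* (d) *)
  /\ (forall (P : seq nat) (I : {mpoly K[2]} -> Prop) (v : 'I_2 -> K),
        cijt_parts K d k d P \/ cijt_parts K d k (d + k - 1) P ->
        graded_ci I -> nonzero_vec v -> jordan_type I (lform v) P ->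
        (forall i s : nat, ~ ((i < size P)%N /\ s = nth 0 P i) ->
           dim_string_space I (lform v) i s 0)
        /\ (forall i : nat, (i < size P)%N ->
              dim_string_space I (lform v) i (nth 0 P i) 1)).
Proof.
have Ed P := cijt_partsP K hd hk P (or_introl (erefl d)).
have Edk P := cijt_partsP K hd hk P (or_intror (erefl (d + k - 1)%N)).
split; last split; last split.
- split; [|split; [|split]].
  + by move=> P /Ed /(type_T_d_iota hd hk)[h1 h2]; split=> //; apply/Edk.
  + by move=> P Q /Ed hP /Ed hQ; apply: (iota_part_inj hd hk hP hQ).
  + move=> Q /Edk /(iota_part_surj hd hk)[P hP <-]; exists P => //; exact/Ed.
  + move=> k2 pc0 P /Ed hP; exists (vanishing_set d k P); split.
      exact: vanishing_setP (or_introl erefl) hP.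
    rewrite -vanishing_set_iota //; have [_ hI] := type_T_d_iota hd hk hP.
    exact: vanishing_setP (or_intror erefl) hI.
- split.
    by apply: has_card_ext (card_type_T_d hd hk) => P; apply: iff_sym.
  by apply: has_card_ext (card_type_T_dk hd hk) => P; apply: iff_sym.
- move=> d2; split=> [a le|].
    apply: has_card_ext (card_smallest hd hk (a := a) _); last by lia.
    by move=> P; split=> -[/Ed h1 h2].
  have [P [[h1 h2] h3]] := unique_smallest hd hk.
  exists P; split=> //; split; first by case: h1 => /Ed.
  by move=> Q [/Ed hQ sQ]; apply: h2.
- move=> P I v _ ci nzv jt; split=> [i s ne|i lt].
    have := dim_string_spaceP ci nzv i s jt.
    by case: ltnP => //= lt; case: eqP => // e; case: ne.
  by have := dim_string_spaceP ci nzv i (nth 0%N P i) jt; rewrite lt eqxx.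
Qed.
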